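(* Let $H$ be a $d$-regular $r$-uniform hypergraph on $n$ vertices, $r\geq 3$. There is a constant $c=c(r)>0$ depending only on $r$ such that: (i) If $d\leq n^{2/3}$, then $\lambda_2^{(r)}(H)\geq c\sqrt{d}$; in general, for any $p\geq 1$, $\lambda_2^{(p)}(H)\geq c\,n^{1-r/p}\sqrt{d}$. (ii) If $d<\frac{n^2}{4}$, then $\mu^{(r)}(H)\geq c\sqrt{d}$; in general, for any $p\geq 1$, $\mu^{(p)}(H)\geq c\,n^{1-r/p}\sqrt{d}$. (iii) If $r\geq 4$ and $\frac{n^2}{4}\leq d\leq \frac{1}{2}\binom{n-1}{r-1}$, then $\mu^{(r)}(H)\geq \frac{cd}{n}$; in general, for any $p\geq 1$, $\mu^{(p)}(H)\geq c\,d\,n^{-r/p}$.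
   Context: For an $r$-uniform hypergraph $H$ on vertex set $V$ with $|V|=n$, its adjacency map is the symmetric multilinear function $\tau_H$ on $(\mathbb{C}^V)^r$ given by $$\tau_H(x_1,\dots,x_r)=\frac{1}{(r-1)!}\sum_{\substack{v_1,\dots,v_r\in V\\ \{v_1,\dots,v_r\}\in E(H)}}x_1(v_1)\cdots x_r(v_r).$$ The normalized adjacency map is $\sigma_H=\tau_H-\frac{r|E(H)|}{n^r}J$, where $J(x_1,\dots,x_r)=\sum_{v_1,\dots,v_r\in V}x_1(v_1)\cdots x_r(v_r)$. For $p>0$, $\|x\|_p=(\sum_v|x(v)|^p)^{1/p}$. Define $$\lambda_2^{(p)}(H)=\sup_{x\in\mathbb{R}^V,\ \|x\|_p=1}\sigma_H(x,\dots,x),\qquad \mu^{(p)}(H)=\sup_{\|x_1\|_p=\dots=\|x_r\|_p=1}|\sigma_H(x_1,\dots,x_r)|.$$ $H$ is $d$-regular if every vertex lies in exactly $d$ edges. *)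

(* Defs.v *)
From HB Require Import structures.
From mathcomp Require Import all_boot all_order all_algebra.
From mathcomp Require Import all_classical all_reals all_analysis.
From mathcomp Require Import complex.
Set Implicit Arguments. Unset Strict Implicit. Unset Printing Implicit Defensive.
Import Order.TTheory GRing.Theory Num.Theory.
Local Open Scope ring_scope.
Local Open Scope classical_set_scope.

Definition uniform (V : finType) (r : nat) (E : {set {set V}}) : Prop :=
  forall e, e \in E -> #|e| = r.

Definition regular (V : finType) (d : nat) (E : {set {set V}}) : Prop :=
  forall v : V, #|[set e in E | v \in e]| = d.

Definition tauH (K : fieldType) (V : finType) (r : nat) (E : {set {set V}})
    (x : 'I_r -> V -> K) : K :=
  ((r.-1)`!)%:R^-1 *
    \sum_(v : {ffun 'I_r -> V} | [set v i | i : 'I_r] \in E)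
       \prod_(i < r) x i (v i).

Definition Jmap (K : fieldType) (V : finType) (r : nat)
    (x : 'I_r -> V -> K) : K :=
  \sum_(v : {ffun 'I_r -> V}) \prod_(i < r) x i (v i).

Definition sigmaH (K : fieldType) (V : finType) (r : nat) (E : {set {set V}})
    (x : 'I_r -> V -> K) : K :=
  tauH E x - ((r * #|E|)%:R / (#|V| ^ r)%:R) * Jmap x.

Definition lpnormR (R : realType) (V : finType) (p : R) (x : V -> R) : R :=
  (\sum_(v : V) `|x v| `^ p) `^ (p^-1).

Definition lpnormC (R : realType) (V : finType) (p : R) (x : V -> R[i]) : R :=
  (\sum_(v : V) (ComplexField.Normc.normc (x v)) `^ p) `^ (p^-1).

Definition lambda2 (R : realType) (V : finType) (r : nat) (E : {set {set V}})
    (p : R) : R :=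
  sup [set sigmaH E (fun _ : 'I_r => x) | x in [set x : V -> R | lpnormR p x = 1]].

Definition mu (R : realType) (V : finType) (r : nat) (E : {set {set V}})
    (p : R) : R :=
  sup [set ComplexField.Normc.normc (sigmaH E x)
        | x in [set x : 'I_r -> V -> R[i] | forall i, lpnormC p (x i) = 1]].

(* Main.v *)
Require Import Defs.
From HB Require Import structures.
From mathcomp Require Import all_boot all_order all_algebra.
From mathcomp Require Import all_classical all_reals all_analysis.
From mathcomp Require Import complex ring lra zify.
Import Order.TTheory GRing.Theory Num.Theory.
Import numFieldNormedType.Exports.
Local Open Scope ring_scope.
Set Implicit Arguments. Unset Strict Implicit. Unset Printing Implicit Defensive.

(** In each case it is enough to find vectors with entries in [[-2, 2]] at which [sigmaH] is
    large; dividing by the l^p norms, which are at most [2 n^(1/p)], gives the bound for every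
    [p].  Write [q = d / n^(r-1)].

    For (ii), take random signs in all variables but one, and let the last variable be the sign
    of the resulting linear form.  Its coefficient at [v] is a decoupled Rademacher chaos with
    second moment [d (1/(r-1)! - q)] and fourth moment at most [3^(r-1)] times the square of
    that, so its mean absolute value is of order [sqrt d].

    For (iii), average [sigmaH (x, x, 1, ..., 1)] over random signs [x]: only the tuples with
    [v_1 = v_2] survive, these are never edges, and the mean is [- q n^(r-1) = - d].

    For (i) a positive value is needed.  Take [x_v = 1 + dl sin(L_v)] with
    [L_v = eps_v / 2 + (eta / sqrt d) * (the sum of eps_w over the neighbours w of v)] for
    independent signs [eps].  The constant and linear terms of [sigmaH] vanish by regularity.
    Correlations of the functions [sin(L_v)] are controlled by the Gram matrix [rho] of the
    coefficient vectors: the mean of [sin(L_u) sin(L_v)] is at least [rho u v / 16], while a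
    covariance inequality for Lipschitz functions bounds the terms of higher order in [dl] by
    [dl^3] times a sum of entries of [rho].  Neighbours have [rho u v >= eta / (2 sqrt d)], so
    the edges gain order [n sqrt d], and the term [q J] costs at most order [d + eta^2 d^2],
    which is smaller when [d <= n^(2/3)] and [n] is large.  For bounded [n] a vector supported
    on one edge, with entry sum zero and positive product, suffices. *)

(** * Averages over independent random signs: moments, cosines, covariances *)

Section RademacherMean.
Variable R : realType.
Implicit Types (n : nat) (F G : seq R -> R) (a : nat -> R) (l : seq R).

(** The signs form a list, so that inductions condition on the first sign; list entries past the end
    read as 0. *)
Fixpoint radmean n F : R :=
  if n is m.+1 then (radmean m (fun l => F (1 :: l)) + radmean m (fun l => F (-1 :: l))) / 2
  else F [::].

Lemma eq_rad n F G : F =1 G -> radmean n F = radmean n G.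
Proof. by elim: n F G => //= n IH F G FG; congr ((_ + _) / _); apply: IH => l. Qed.

Lemma le_rad n F G : (forall l, F l <= G l) -> radmean n F <= radmean n G.
Proof.
elim: n F G => //= n IH F G FG.
have h1 := IH (fun l => F (1 :: l)) (fun l => G (1 :: l)) (fun l => FG _).
have h2 := IH (fun l => F (-1 :: l)) (fun l => G (-1 :: l)) (fun l => FG _).
lra.
Qed.

Lemma radD n F G : radmean n (fun l => F l + G l) = radmean n F + radmean n G.
Proof. by elim: n F G => //= n IH F G; rewrite !IH; field. Qed.

Lemma radZ n (c : R) F : radmean n (fun l => c * F l) = c * radmean n F.
Proof. by elim: n F => //= n IH F; rewrite !IH; field. Qed.

Lemma radB n F G : radmean n (fun l => F l - G l) = radmean n F - radmean n G.
Proof.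
rewrite (eq_rad n (G := fun l => F l + (-1) * G l)) => [|l]; last by ring.
by rewrite radD radZ; ring.
Qed.

Lemma rad_cst n (c : R) : radmean n (fun=> c) = c.
Proof. by elim: n => //= n IH; rewrite !IH; field. Qed.

Lemma rad_sum n (I : Type) (s : seq I) (P : pred I) (F : I -> seq R -> R) :
  radmean n (fun l => \sum_(i <- s | P i) F i l) = \sum_(i <- s | P i) radmean n (F i).
Proof.
elim: s => [|i s IH].
  by rewrite big_nil -[RHS](rad_cst n); apply: eq_rad => l; rewrite big_nil.
rewrite big_cons -IH; case: ifP => Pi.
  by rewrite -radD; apply: eq_rad => l; rewrite big_cons Pi.
by apply: eq_rad => l; rewrite big_cons Pi.
Qed.

(** At each coordinate keep the sign with the larger conditional mean. The bound covers every index
    because of the default entry 0. *)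
Lemma rad_exists n F :
  exists2 l, (forall i, `|l`_i| <= 1) & radmean n F <= F l.
Proof.
elim: n F => [|n IH] F /=.
  by exists [::] => // i; rewrite nth_nil normr0.
have [l1 hl1 h1] := IH (fun l => F (1 :: l)).
have [l2 hl2 h2] := IH (fun l => F (-1 :: l)).
have [h|h] := lerP (radmean n (fun l => F (-1 :: l))) (radmean n (fun l => F (1 :: l))).
  exists (1 :: l1); first by case=> [|i] /=; rewrite ?normr1.
  apply: le_trans h1; lra.
exists (-1 :: l2); first by case=> [|i] /=; rewrite ?normrN1.
apply: le_trans h2; lra.
Qed.

Definition linsum n a l : R := \sum_(i < n) a i * l`_i.

Lemma linsum_cons n a (c : R) l :
  linsum n.+1 a (c :: l) = a 0 * c + linsum n (fun i => a i.+1) l.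
Proof. by rewrite /linsum big_ord_recl. Qed.

(** The sine parts cancel between the two values of a sign and leave the factor [cos (a i)]; the
    shift [b] carries the signs already fixed. *)
Lemma rad_cos n (b : R) a :
  radmean n (fun l => cos (b + linsum n a l)) = cos b * \prod_(i < n) cos (a i).
Proof.
elim: n b a => [|n IH] b a /=; first by rewrite /linsum !big_ord0 addr0 mulr1.
rewrite (eq_rad n (G := fun l => cos (b + a 0 + linsum n (fun i => a i.+1) l))); last first.
  by move=> l; rewrite linsum_cons mulr1 addrA.
rewrite [X in _ + X](eq_rad n (G := fun l => cos (b - a 0 + linsum n (fun i => a i.+1) l))); last first.
  by move=> l; rewrite linsum_cons mulrN1 addrA.
by rewrite !IH big_ord_recl /= cosB cosD; field.
Qed.

Lemma rad_sin n a : radmean n (fun l => sin (linsum n a l)) = 0.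
Proof.
rewrite (eq_rad n (G := fun l => cos (- (pi / 2) + linsum n a l))) => [|l].
  by rewrite rad_cos cosN cos_pihalf mul0r.
by rewrite cosD cosN cos_pihalf sinN sin_pihalf; ring.
Qed.

Definition coordlip n F a :=
  forall l l', `|F l - F l'| <= \sum_(i < n) a i * `|l`_i - l'`_i|.

Lemma coordlip_cons n F a (c : R) :
  coordlip n.+1 F a -> coordlip n (fun l => F (c :: l)) (fun i => a i.+1).
Proof.
by move=> h l l'; apply: le_trans (h _ _) _; rewrite big_ord_recl /= subrr normr0 mulr0 add0r.
Qed.

Lemma coordlip_head n F a l :
  coordlip n.+1 F a -> `|F (1 :: l) - F (-1 :: l)| <= 2 * a 0.
Proof.
move=> h; apply: le_trans (h _ _) _; rewrite big_ord_recl /= big1 => [|i _].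
  by rewrite opprK ger0_norm ?addr0; lra.
by rewrite subrr normr0 mulr0.
Qed.

(** Law of total covariance for the first sign. The conditional covariances are bounded by
    induction; that of the conditional means is [(f1 - f2) * (g1 - g2) / 4], at most [a 0 * b 0]. *)
Lemma rad_covariance n F G a b : coordlip n F a -> coordlip n G b ->
  `|radmean n (fun l => F l * G l) - radmean n F * radmean n G| <= \sum_(i < n) a i * b i.
Proof.
elim: n F G a b => [|n IH] F G a b Fa Gb /=; first by rewrite subrr normr0 big_ord0.
have h c := IH _ _ _ _ (coordlip_cons c Fa) (coordlip_cons c Gb).
have h1 := h 1; have {h} h2 := h (-1).
have d0 H c : coordlip n.+1 H c ->
    `|radmean n (fun l => H (1 :: l)) - radmean n (fun l => H (-1 :: l))| <= 2 * c 0.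
  move=> Hc; rewrite -radB ler_norml; apply/andP; split.
    rewrite -[leLHS](rad_cst n); apply: le_rad => l.
    by have := coordlip_head l Hc; rewrite ler_norml => /andP[].
  rewrite -[leRHS](rad_cst n); apply: le_rad => l.
  by have := coordlip_head l Hc; rewrite ler_norml => /andP[].
have {d0} := (d0 _ _ Fa, d0 _ _ Gb).
rewrite big_ord_recl /=.
move: h1 h2.
set p1 := radmean n (fun l => F (1 :: l) * _); set p2 := radmean n (fun l => F (-1 :: l) * _).
set f1 := radmean n (fun l => F (1 :: l)); set f2 := radmean n (fun l => F (-1 :: l)).
set g1 := radmean n (fun l => G (1 :: l)); set g2 := radmean n (fun l => G (-1 :: l)).
set S := \sum_(i < n) _ => h1 h2 [hf hg].
have -> : (p1 + p2) / 2 - (f1 + f2) / 2 * ((g1 + g2) / 2) =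
  (f1 - f2) * (g1 - g2) / 4 + ((p1 - f1 * g1) / 2 + (p2 - f2 * g2) / 2) by field.
apply: le_trans (ler_normD _ _) _; apply: lerD; last first.
  apply: le_trans (ler_normD _ _) _.
  by rewrite !normrM (ger0_norm (_ : 0 <= 2^-1)) //; lra.
rewrite !normrM (ger0_norm (_ : 0 <= 4^-1)) //.
have : `|f1 - f2| * `|g1 - g2| <= 2 * a 0 * (2 * b 0) by apply: ler_pM.
lra.
Qed.

Lemma rad_sqr n (c : R) a :
  radmean n (fun l => (c + linsum n a l) ^+ 2) = c ^+ 2 + \sum_(i < n) a i ^+ 2.
Proof.
elim: n c a => [|n IH] c a /=; first by rewrite /linsum !big_ord0 !addr0.
rewrite (eq_rad n (G := fun l => (c + a 0 + linsum n (fun i => a i.+1) l) ^+ 2)); last first.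
  by move=> l; rewrite linsum_cons mulr1 addrA.
rewrite [X in _ + X](eq_rad n (G := fun l => (c - a 0 + linsum n (fun i => a i.+1) l) ^+ 2)); last first.
  by move=> l; rewrite linsum_cons mulrN1 addrA.
by rewrite !IH big_ord_recl /=; field.
Qed.

Lemma rad_pow4 n (c : R) a (A := \sum_(i < n) a i ^+ 2) :
  radmean n (fun l => (c + linsum n a l) ^+ 4) <= c ^+ 4 + 6 * c ^+ 2 * A + 3 * A ^+ 2.
Proof.
rewrite /A {A}; elim: n c a => [|n IH] c a /=.
  by rewrite /linsum !big_ord0 !addr0; lra.
rewrite (eq_rad n (G := fun l => (c + a 0 + linsum n (fun i => a i.+1) l) ^+ 4)); last first.
  by move=> l; rewrite linsum_cons mulr1 addrA.
rewrite [X in _ + X](eq_rad n (G := fun l => (c - a 0 + linsum n (fun i => a i.+1) l) ^+ 4)); last first.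
  by move=> l; rewrite linsum_cons mulrN1 addrA.
have h1 := IH (c + a 0) (fun i => a i.+1); have h2 := IH (c - a 0) (fun i => a i.+1).
rewrite big_ord_recl /=; move: h1 h2; set S := \sum_(i < n) _ ^+ 2 => h1 h2.
have h0 : 0 <= a 0 ^+ 4 by rewrite (exprM _ 2 2) sqr_ge0.
(* The average of the two inductive bounds equals this expression, so the slack is
   [2 * a 0 ^+ 4]. *)
apply: le_trans (_ : c ^+ 4 + 6 * c ^+ 2 * (a 0 ^+ 2 + S) + 3 * (a 0 ^+ 2 + S) ^+ 2
   - 2 * a 0 ^+ 4 <= _); last by lra.
move: h1 h2; rewrite -(ler_pM2l (_ : 0 < 2)) // => h1; rewrite -(ler_pM2l (_ : 0 < 2)) // => h2.
lra.
Qed.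

Lemma rad_cauchy_schwarz n F G :
  radmean n (fun l => F l * G l) ^+ 2 <= radmean n (fun l => F l ^+ 2) * radmean n (fun l => G l ^+ 2).
Proof.
set A := radmean n (fun l => F l ^+ 2); set B := radmean n (fun l => G l ^+ 2).
set C := radmean n _.
have A0 : 0 <= A by rewrite -(rad_cst n 0); apply: le_rad => l; exact: sqr_ge0.
have B0 : 0 <= B by rewrite -(rad_cst n 0); apply: le_rad => l; exact: sqr_ge0.
have h x y : 0 <= x ^+ 2 * A + 2 * x * y * C + y ^+ 2 * B.
  rewrite -!radZ -!radD -[leLHS](rad_cst n); apply: le_rad => l.
  rewrite (_ : _ + _ = (x * F l + y * G l) ^+ 2) ?sqr_ge0 //; ring.
(* The quadratic form at [(B, - C)] equals [B * (A * B - C ^+ 2)], which settles [B > 0]; the other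
   points force [C = 0] when [B = 0]. *)
have := h B (- C); have := h (- C) A; have := h 1 (- C); have := h (-C) 1.
have [->|Bn0] := eqVneq B 0; first by nra.
have Bp : 0 < B by lra.
nra.
Qed.

(* Minkowski's inequality in the L^2 norm of [radmean], in a form without square roots. *)
Lemma rad_minkowski n (k A B : R) F G : 0 <= k -> 0 <= A -> 0 <= B ->
  radmean n (fun l => F l ^+ 2) <= k * A ^+ 2 -> radmean n (fun l => G l ^+ 2) <= k * B ^+ 2 ->
  radmean n (fun l => (F l + G l) ^+ 2) <= k * (A + B) ^+ 2.
Proof.
move=> k0 A0 B0 hF hG.
rewrite (eq_rad n (G := fun l => F l ^+ 2 + (2 * (F l * G l) + G l ^+ 2))) => [|l]; last by ring.
rewrite radD radD radZ.
suff : radmean n (fun l => F l * G l) <= k * (A * B) by lra.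
have [//|] := boolP (radmean n (fun l => F l * G l) <= k * (A * B)).
rewrite -ltNge => h; exfalso.
have := rad_cauchy_schwarz n F G.
have F0 : 0 <= radmean n (fun l => F l ^+ 2).
  by rewrite -(rad_cst n 0); apply: le_rad => l; exact: sqr_ge0.
have G0 : 0 <= radmean n (fun l => G l ^+ 2).
  by rewrite -(rad_cst n 0); apply: le_rad => l; exact: sqr_ge0.
have h1 : (k * (A * B)) ^+ 2 < radmean n (fun l => F l * G l) ^+ 2.
  by rewrite ltr_sqr ?nnegrE // ?mulr_ge0 //; apply: ltW; apply: le_lt_trans h; rewrite !mulr_ge0.
have : radmean n (fun l => F l ^+ 2) * radmean n (fun l => G l ^+ 2) <= (k * A ^+ 2) * (k * B ^+ 2).
  exact: ler_pM.
have -> : k * A ^+ 2 * (k * B ^+ 2) = (k * (A * B)) ^+ 2 by ring.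
lra.
Qed.

End RademacherMean.

(** * Trigonometric inequalities and correlations of sines of random linear forms *)

Section Trigonometry.
Variable R : realType.
Implicit Types x y : R.

Lemma continuous_sin_within (a b : R) : {within `[a, b], continuous (@sin R)}%classic.
Proof. by apply: continuous_subspaceT => x; exact: continuous_sin. Qed.

Lemma norm_sinB x y : `|sin x - sin y| <= `|x - y|.
Proof.
wlog yx : x y / y <= x.
  by move=> h; case: (leP y x) => [/h//|/ltW/h]; rewrite distrC (distrC y).
have [c _ ->] := MVT_segment yx (fun z _ => is_derive_sin z) (@continuous_sin_within y x).
by rewrite normrM -[leRHS]mul1r ler_wpM2r ?normr_ge0 // ler_norml cos_geN1 cos_le1.
Qed.

Lemma norm_sin_le x : `|sin x| <= `|x|.
Proof. by have := norm_sinB x 0; rewrite sin0 !subr0. Qed.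

Lemma norm_sin_le1 x : `|sin x| <= 1.
Proof. by rewrite ler_norml sin_geN1 sin_le1. Qed.

Lemma cos_ge_quadratic x : 1 - x ^+ 2 / 2 <= cos x.
Proof.
have -> : cos x = 1 - 2 * sin (x / 2) ^+ 2.
  have {1}-> : x = x / 2 + x / 2 by field.
  by rewrite cosD -!expr2; have := cos2Dsin2 (x / 2); lra.
have : sin (x / 2) ^+ 2 <= (x / 2) ^+ 2.
  by rewrite -[leLHS]real_normK ?num_real // -[leRHS]real_normK ?num_real // lerXn2r ?nnegrE ?norm_sin_le.
lra.
Qed.

Lemma sin_ge_half x : 0 <= x <= 1 -> x / 2 <= sin x.
Proof.
move=> /andP[x0 x1].
have [c /itvP hc h] := MVT_segment x0 (fun z _ => is_derive_sin z) (@continuous_sin_within 0 x).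
move: h; rewrite sin0 !subr0 => ->.
have c0 : 0 <= c by rewrite hc.
have cx : c <= x by rewrite hc.
rewrite mulrC ler_wpM2r //; apply: le_trans (cos_ge_quadratic c).
nra.
Qed.

Lemma prod_subr_ge n (t : nat -> R) : (forall i, 0 <= t i <= 1) ->
  1 - \sum_(i < n) t i <= \prod_(i < n) (1 - t i).
Proof.
move=> ht; elim: n => [|n IH]; first by rewrite !big_ord0 subr0.
have /andP[t0 t1] := ht n.
have p1 : \prod_(i < n) (1 - t i) <= 1.
  by apply: prodr_ile1 => i _; have /andP[? ?] := ht i; apply/andP; split; lra.
rewrite !big_ord_recr /=; nra.
Qed.

(** In the expansion of the right side the terms with at most one factor [s i] suffice, since
    omitting a factor [c i <= 1] only increases a product. *)
Lemma prod_addr_ge n (c s : nat -> R) : (forall i, 0 <= c i <= 1) -> (forall i, 0 <= s i) ->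
  (\prod_(i < n) c i) * (1 + \sum_(i < n) s i) <= \prod_(i < n) (c i + s i).
Proof.
move=> hc hs; elim: n => [|n IH]; first by rewrite !big_ord0 addr0 mulr1.
have /andP[c0 c1] := hc n; have s0 := hs n.
have p0 : 0 <= \prod_(i < n) c i by apply: prodr_ge0 => i _; have /andP[] := hc i.
have S0 : 0 <= \sum_(i < n) s i by apply: sumr_ge0.
rewrite !big_ord_recr /=.
apply: le_trans (_ : (\prod_(i < n) c i) * (1 + \sum_(i < n) s i) * (c n + s n) <= _); last first.
  by rewrite ler_wpM2r //; lra.
set p := \prod_(i < n) c i in p0 *; set S := \sum_(i < n) s i in S0 *.
rewrite -subr_ge0.
have -> : p * (1 + S) * (c n + s n) - p * c n * (1 + (S + s n)) =
  p * (s n * (1 + S - c n)) by ring.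
apply: mulr_ge0 => //; apply: mulr_ge0 => //; lra.
Qed.

Lemma linsumD n (a b : nat -> R) (l : seq R) :
  linsum n (fun i => a i + b i) l = linsum n a l + linsum n b l.
Proof. by rewrite /linsum -big_split /=; apply: eq_bigr => i _; ring. Qed.

Lemma linsumB n (a b : nat -> R) (l : seq R) :
  linsum n (fun i => a i - b i) l = linsum n a l - linsum n b l.
Proof. by rewrite /linsum -sumrB /=; apply: eq_bigr => i _; ring. Qed.

(* The mean of [cos (A - B) - cos (A + B)] is a difference of two products of cosines
   whose factors are [cos a_i cos b_i +- sin a_i sin b_i]. *)
Lemma rad_sin_sin_ge n (a b : nat -> R) :
  (forall i, 0 <= a i <= 2^-1) -> (forall i, 0 <= b i <= 2^-1) ->
  \sum_(i < n) a i ^+ 2 <= 2^-1 -> \sum_(i < n) b i ^+ 2 <= 2^-1 ->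
  (\sum_(i < n) a i * b i) / 16 <= radmean n (fun l => sin (linsum n a l) * sin (linsum n b l)).
Proof.
move=> ha hb Sa Sb.
have -> : radmean n (fun l => sin (linsum n a l) * sin (linsum n b l)) =
    2^-1 * (\prod_(i < n) cos (a i - b i) - \prod_(i < n) cos (a i + b i)).
  rewrite (eq_rad n (G := fun l => 2^-1 * (cos (0 + linsum n (fun i => a i - b i) l)
       - cos (0 + linsum n (fun i => a i + b i) l)))); last first.
    by move=> l; rewrite !add0r linsumB linsumD cosB cosD; field.
  by rewrite radZ radB !rad_cos cos0 !mul1r.
have cosa (z : R) : 0 <= z <= 2^-1 -> 2^-1 <= cos z.
  by move=> /andP[? ?]; apply: le_trans (cos_ge_quadratic z); nra.
have sina (z : R) : 0 <= z <= 2^-1 -> z / 2 <= sin z.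
  by move=> /andP[? ?]; apply: sin_ge_half; apply/andP; split => //; lra.
pose c i := cos (a i) * cos (b i); pose s i := sin (a i) * sin (b i).
have hc i : 0 <= c i <= 1.
  rewrite /c; have := cosa _ (ha i); have := cosa _ (hb i) => h1 h2.
  apply/andP; split; first by apply: mulr_ge0; lra.
  by apply: mulr_ile1; rewrite ?cos_le1 //; lra.
have hs i : a i * b i / 4 <= s i.
  have := sina _ (ha i); have := sina _ (hb i); have /andP[? ?] := ha i; have /andP[? ?] := hb i.
  move=> h1 h2; apply: le_trans (_ : (a i / 2) * (b i / 2) <= _); first by lra.
  by apply: ler_pM => //; lra.
have hs0 i : 0 <= s i.
  apply: le_trans (hs i); have /andP[? ?] := ha i; have /andP[? ?] := hb i.
  by apply: mulr_ge0 => //; apply: mulr_ge0.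
(* The bounds on the sums of squares enter here: the product is at least 1 minus half of their
   total. *)
have hP : 2^-1 <= \prod_(i < n) c i.
  pose t i := (a i ^+ 2 + b i ^+ 2) / 2.
  have ht i : 0 <= t i <= 1.
    have /andP[? ?] := ha i; have /andP[? ?] := hb i; rewrite /t.
    by apply/andP; split; nra.
  apply: le_trans (_ : \prod_(i < n) (1 - t i) <= _).
    apply: le_trans (prod_subr_ge n ht).
    by rewrite /t -mulr_suml big_split /=; lra.
  apply: ler_prod => i _; have /andP[? ?] := ht i; apply/andP; split; first by lra.
  have h1 := cos_ge_quadratic (a i); have h2 := cos_ge_quadratic (b i).
  have /andP[? ?] := ha i; have /andP[? ?] := hb i.
  apply: le_trans (_ : (1 - a i ^+ 2 / 2) * (1 - b i ^+ 2 / 2) <= _).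
    rewrite /t; nra.
  by apply: ler_pM => //; nra.
have h1 := prod_addr_ge n hc hs0.
have -> : \prod_(i < n) cos (a i - b i) = \prod_(i < n) (c i + s i).
  by apply: eq_bigr => i _; rewrite cosB.
have h2 : \prod_(i < n) cos (a i + b i) <= \prod_(i < n) c i.
  apply: ler_prod => i _; have /andP[? ?] := ha i; have /andP[? ?] := hb i; apply/andP; split.
    by apply: le_trans (cos_ge_quadratic _); nra.
  by rewrite cosD; have := hs0 i; rewrite /c /s; lra.
(* Together with [hP] and the leading 1/2 this gives the constant 1/2 * 1/2 * 1/4 = 1/16. *)
have h3 : (\sum_(i < n) a i * b i) / 4 <= \sum_(i < n) s i.
  by rewrite mulr_suml; apply: ler_sum => i _; exact: hs.
have S0 : 0 <= \sum_(i < n) s i by apply: sumr_ge0.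
nra.
Qed.

End Trigonometry.

(** * Lipschitz bounds and means for products of factors 1 + dl sin(L_v) *)

Section BiasedProducts.
Variable R : realType.

Lemma coordlipW n (F : seq R -> R) (a b : nat -> R) :
  (forall i, a i <= b i) -> coordlip n F a -> coordlip n F b.
Proof.
move=> ab Fa l l'; apply: le_trans (Fa _ _) _; apply: ler_sum => i _.
by rewrite ler_wpM2r.
Qed.

Lemma eq_coordlip n (F G : seq R -> R) (a : nat -> R) :
  F =1 G -> coordlip n F a -> coordlip n G a.
Proof. by move=> FG Fa l l'; rewrite -!FG. Qed.

Lemma coordlip0 n (c : R) : coordlip n (fun=> c) (fun=> 0).
Proof. by move=> l l'; rewrite subrr normr0 sumr_ge0 // => i _; rewrite mul0r. Qed.

Lemma coordlipD n (F G : seq R -> R) (a b : nat -> R) :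
  coordlip n F a -> coordlip n G b ->
  coordlip n (fun l => F l + G l) (fun i => a i + b i).
Proof.
move=> Fa Gb l l'; rewrite opprD addrACA; apply: le_trans (ler_normD _ _) _.
apply: le_trans (lerD (Fa l l') (Gb l l')) _.
by rewrite -big_split /=; apply: ler_sum => i _; rewrite mulrDl.
Qed.

Lemma coordlipZ n (c : R) (F : seq R -> R) (a : nat -> R) : 0 <= c ->
  coordlip n F a -> coordlip n (fun l => c * F l) (fun i => c * a i).
Proof.
move=> c0 Fa l l'; rewrite -mulrBr normrM ger0_norm //.
apply: le_trans (ler_wpM2l c0 (Fa l l')) _.
by rewrite mulr_sumr; apply: ler_sum => i _; rewrite mulrA.
Qed.

Lemma coordlipM n (F G : seq R -> R) (a b : nat -> R) (A B : R) :
  (forall l, `|F l| <= A) -> (forall l, `|G l| <= B) ->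
  coordlip n F a -> coordlip n G b ->
  coordlip n (fun l => F l * G l) (fun i => B * a i + A * b i).
Proof.
move=> FA GB Fa Gb l l'.
have -> : F l * G l - F l' * G l' = (F l - F l') * G l + F l' * (G l - G l') by ring.
apply: le_trans (ler_normD _ _) _; rewrite !normrM.
have h1 : `|F l - F l'| * `|G l| <= (\sum_(i < n) a i * `|l`_i - l'`_i|) * B by apply: ler_pM.
have h2 : `|F l'| * `|G l - G l'| <= A * (\sum_(i < n) b i * `|l`_i - l'`_i|) by apply: ler_pM.
apply: le_trans (lerD h1 h2) _; rewrite mulr_suml mulr_sumr -big_split /=.
by apply: ler_sum => i _; rewrite le_eqVlt; apply/orP; left; apply/eqP; ring.
Qed.

Lemma coordlip_sum n (T : Type) (s : seq T) (F : T -> seq R -> R) (a : T -> nat -> R) :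
  (forall v, coordlip n (F v) (a v)) ->
  coordlip n (fun l => \sum_(v <- s) F v l) (fun i => \sum_(v <- s) a v i).
Proof.
move=> Fa; elim: s => [|v s IH].
  apply: (@eq_coordlip _ (fun=> 0)) => [l|]; first by rewrite big_nil.
  by apply: coordlipW (coordlip0 n 0) => i; rewrite big_nil.
apply: (@eq_coordlip _ (fun l => F v l + \sum_(v <- s) F v l)) => [l|]; first by rewrite big_cons.
by apply: coordlipW (coordlipD (Fa v) IH) => i; rewrite big_cons.
Qed.

Variables (n : nat) (T : Type) (th : T -> nat -> R) (dl : R).
Hypothesis th_itv : forall v i, 0 <= th v i <= 2^-1.
Hypothesis th_sqr : forall v, \sum_(i < n) th v i ^+ 2 <= 2^-1.
Hypothesis dl_itv : 0 <= dl <= 1.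

Definition sinlin (v : T) (l : seq R) : R := sin (linsum n (th v) l).
Definition rho (u v : T) : R := \sum_(i < n) th u i * th v i.
Definition biased_prod (s : seq T) (l : seq R) : R := \prod_(v <- s) (1 + dl * sinlin v l).
Let sumth (s : seq T) (i : nat) : R := \sum_(v <- s) th v i.
(** [D] removes the constant term of the product and [Rm] also the part linear in [dl]; their
    Lipschitz coefficients are of order [dl] and [dl ^+ 2]. *)
Let D s l := biased_prod s l - 1.
Let Rm s l := D s l - dl * \sum_(v <- s) sinlin v l.

Lemma norm_sinlin v l : `|sinlin v l| <= 1.
Proof. exact: norm_sin_le1. Qed.

Lemma coordlip_sinlin v : coordlip n (sinlin v) (th v).
Proof.
move=> l l'; apply: le_trans (norm_sinB _ _) _.
rewrite /linsum -sumrB; apply: le_trans (ler_norm_sum _ _ _) _; apply: ler_sum => i _.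
by rewrite -mulrBr normrM ger0_norm //; have /andP[] := th_itv v i.
Qed.

Lemma rad_sinlin v : radmean n (sinlin v) = 0.
Proof. exact: rad_sin. Qed.

Lemma rho_ge0 u v : 0 <= rho u v.
Proof.
by apply: sumr_ge0 => i _; apply: mulr_ge0;
  [have /andP[] := th_itv u i | have /andP[] := th_itv v i].
Qed.

Let sumth_ge0 s i : 0 <= sumth s i.
Proof. by apply: sumr_ge0 => v _; have /andP[] := th_itv v i. Qed.

Lemma norm_biased_prod s l : `|biased_prod s l| <= 2 ^+ size s.
Proof.
elim: s => [|v s IH]; first by rewrite /biased_prod big_nil normr1.
rewrite /biased_prod big_cons normrM exprS; apply: ler_pM => //.
have := norm_sinlin v l; have /andP[? ?] := dl_itv.
rewrite !ler_norml => /andP[? ?]; apply/andP; split; nra.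
Qed.

Let D_cons v s l : D (v :: s) l = D s l + dl * (sinlin v l * biased_prod s l).
Proof. by rewrite /D /biased_prod big_cons; ring. Qed.

Let Rm_cons v s l : Rm (v :: s) l = Rm s l + dl * (sinlin v l * D s l).
Proof. by rewrite /Rm D_cons /D big_cons; ring. Qed.

Let pow24 k : 2 ^+ k <= 4 ^+ k :> R.
Proof. by rewrite lerXn2r ?nnegrE //; lra. Qed.

Let norm_D s l : `|D s l| <= dl * 4 ^+ size s.
Proof.
have /andP[d0 d1] := dl_itv; elim: s => [|v s IH].
  by rewrite /D /biased_prod big_nil subrr normr0 mulr_ge0.
rewrite D_cons; apply: le_trans (ler_normD _ _) _; rewrite /= exprS.
have h : `|dl * (sinlin v l * biased_prod s l)| <= dl * 4 ^+ size s.
  rewrite normrM (ger0_norm d0) ler_wpM2l // normrM.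
  apply: le_trans (_ : 1 * 2 ^+ size s <= _); last by rewrite mul1r.
  by apply: ler_pM => //; [exact: norm_sinlin | exact: norm_biased_prod].
have : 0 <= dl * 4 ^+ size s by apply: mulr_ge0 => //; exact: exprn_ge0.
lra.
Qed.

Let lip_D s : coordlip n (D s) (fun i => dl * 4 ^+ size s * sumth s i).
Proof.
have /andP[d0 d1] := dl_itv; elim: s => [|v s IH].
  apply: (@eq_coordlip _ (fun=> 0)) => [l|]; first by rewrite /D /biased_prod big_nil subrr.
  by apply: coordlipW (coordlip0 n 0) => i; rewrite /sumth big_nil mulr0.
apply: (@eq_coordlip _ (fun l => D s l + dl * (sinlin v l * biased_prod s l))).
  by move=> l; rewrite D_cons.
have lQ : coordlip n (biased_prod s) (fun i => dl * 4 ^+ size s * sumth s i + 0).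
  by apply: (eq_coordlip _ (coordlipD IH (coordlip0 n 1))) => l; rewrite /D subrK.
apply: coordlipW (coordlipD IH (coordlipZ d0 (coordlipM (norm_sinlin v)
   (norm_biased_prod s) (coordlip_sinlin v) lQ))) => i.
rewrite /= exprS /sumth big_cons -/(sumth s i).
have := sumth_ge0 s i; have /andP[t0 _] := th_itv v i; have := pow24 (size s).
have : 0 <= 2 ^+ size s :> R by exact: exprn_ge0.
set A := 4 ^+ size s; set B := 2 ^+ size s; set S := sumth s i; set t := th v i in t0 *.
move=> B0 BA S0.
have h1 : dl * (B * t) <= dl * (A * t) by rewrite ler_wpM2l // ler_wpM2r.
have h2 : dl * (dl * (A * S)) <= dl * (A * S).
  by apply: ler_piMl => //; apply: mulr_ge0 => //; apply: mulr_ge0 => //; lra.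
have h3 : 0 <= dl * (A * t) by apply: mulr_ge0 => //; apply: mulr_ge0 => //; lra.
have h4 : 0 <= dl * (A * S) by apply: mulr_ge0 => //; apply: mulr_ge0 => //; lra.
lra.
Qed.

Let lip_Rm s : coordlip n (Rm s) (fun i => dl ^+ 2 * 4 ^+ size s * sumth s i).
Proof.
have /andP[d0 d1] := dl_itv; elim: s => [|v s IH].
  apply: (@eq_coordlip _ (fun=> 0)) => [l|].
    by rewrite /Rm /D /biased_prod !big_nil subrr mulr0 subr0.
  by apply: coordlipW (coordlip0 n 0) => i; rewrite /sumth big_nil mulr0.
apply: (@eq_coordlip _ (fun l => Rm s l + dl * (sinlin v l * D s l))).
  by move=> l; rewrite Rm_cons.
apply: coordlipW (coordlipD IH (coordlipZ d0 (coordlipM (norm_sinlin v)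
   (norm_D s) (coordlip_sinlin v) (lip_D s)))) => i.
rewrite /= [4 ^+ _.+1]exprS /sumth big_cons -/(sumth s i).
have := sumth_ge0 s i; have /andP[t0 _] := th_itv v i.
have : 0 <= 4 ^+ size s :> R by exact: exprn_ge0.
set A := 4 ^+ size s; set S := sumth s i; set t := th v i in t0 *.
move=> A0 S0.
have h3 : 0 <= dl ^+ 2 * (A * t) by apply: mulr_ge0; rewrite ?sqr_ge0 // mulr_ge0.
have h4 : 0 <= dl ^+ 2 * (A * S) by apply: mulr_ge0; rewrite ?sqr_ge0 // mulr_ge0.
lra.
Qed.

(** The new factor adds the mean of [dl * sinlin v * biased_prod s]. Its linear part has mean 0, the
    pair correlations give at least [dl ^+ 2 / 16] times the sum of [rho v u], and by the covariance
    inequality the remainder [Rm] costs at most half of that. *)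
Lemma rad_biased_prod_cons v s : dl * 4 ^+ size s <= 32^-1 ->
  radmean n (biased_prod s) + dl ^+ 2 / 32 * \sum_(u <- s) rho v u <=
  radmean n (biased_prod (v :: s)).
Proof.
move=> hdl; have /andP[d0 d1] := dl_itv.
rewrite (@eq_rad _ _ (biased_prod (v :: s)) (fun l => biased_prod s l +
   (dl * sinlin v l + (dl ^+ 2 * (\sum_(u <- s) sinlin v l * sinlin u l) +
     dl * (sinlin v l * Rm s l))))); last first.
  by move=> l; rewrite /biased_prod big_cons -mulr_sumr /Rm /D /biased_prod; ring.
rewrite !radD !radZ rad_sinlin rad_sum mulr0 add0r.
have := rad_covariance (coordlip_sinlin v) (@lip_Rm s).
rewrite rad_sinlin mul0r subr0.
have -> : \sum_(i < n) th v i * (dl ^+ 2 * 4 ^+ size s * sumth s i) =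
    dl ^+ 2 * 4 ^+ size s * \sum_(u <- s) rho v u.
  rewrite /rho exchange_big /= mulr_sumr; apply: eq_bigr => i _.
  by rewrite /sumth !mulr_sumr; apply: eq_bigr => u _; ring.
rewrite ler_norml => /andP[h1 _].
have h2 : (\sum_(u <- s) rho v u) / 16 <= \sum_(u <- s) radmean n (fun l => sinlin v l * sinlin u l).
  by rewrite mulr_suml; apply: ler_sum => u _; apply: rad_sin_sin_ge.
have S0 : 0 <= \sum_(u <- s) rho v u by apply: sumr_ge0 => u _; exact: rho_ge0.
move: h1 h2 S0; set S := \sum_(u <- s) rho v u; set M := radmean n _; set K := \sum_(u <- s) _ => h1 h2 S0.
rewrite lerD2l.
have h3 : dl ^+ 2 * (S / 16) <= dl ^+ 2 * K by rewrite ler_wpM2l ?sqr_ge0.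
have h4 : dl * (- (dl ^+ 2 * 4 ^+ size s * S)) <= dl * M by rewrite ler_wpM2l.
have h5 : dl ^+ 2 * S * (dl * 4 ^+ size s) <= dl ^+ 2 * S * 32^-1.
  by apply: ler_wpM2l => //; apply: mulr_ge0 => //; exact: sqr_ge0.
lra.
Qed.

Lemma rad_biased_prod_ge (g : R) s : 0 <= g -> dl * 4 ^+ size s <= 32^-1 ->
  pairwise (fun u v => g <= rho u v) s -> (1 < size s)%N ->
  1 + dl ^+ 2 / 32 * g <= radmean n (biased_prod s).
Proof.
move=> g0 hdl pw s1; have /andP[d0 d1] := dl_itv.
(* The conditional gain lets the induction start at the empty list. Only the pair of the first two
   entries is counted; all other increments are merely nonnegative. *)
have {s1} -> : g = (if (1 < size s)%N then g else 0) by rewrite s1.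
elim: s hdl pw => [|v s IH] /= hdl.
  rewrite (@eq_rad _ _ (biased_prod [::]) (fun=> 1)) => [|l]; last by rewrite /biased_prod big_nil.
  by rewrite rad_cst; lra.
rewrite -/(pairwise _ _) => /andP[hv pw].
have hdl' : dl * 4 ^+ size s <= 32^-1.
  apply: le_trans hdl; rewrite ler_wpM2l // exprS.
  by have : 0 <= 4 ^+ size s :> R; [exact: exprn_ge0 | lra].
have {IH} := IH hdl' pw; have := rad_biased_prod_cons v hdl'.
have q0 : 0 <= dl ^+ 2 / 32 by rewrite mulr_ge0 ?sqr_ge0.
case: s hv {hdl hdl' pw} => [|u s] /=; first by rewrite big_nil; lra.
move=> /andP[hu _] h1 h2; apply: le_trans h1.
have : dl ^+ 2 / 32 * g <= dl ^+ 2 / 32 * \sum_(w <- u :: s) rho v w.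
  rewrite ler_wpM2l // big_cons; apply: le_trans hu _.
  by rewrite lerDl sumr_ge0 // => w _; exact: rho_ge0.
have : 0 <= dl ^+ 2 / 32 * (if (1 < (size s).+1)%N then g else 0).
  by rewrite mulr_ge0 //; case: ifP.
lra.
Qed.

(** The covariance inequality applied to the sum and itself, whose mean is 0. *)
Lemma rad_sqr_sum_sinlin (s : seq T) :
  radmean n (fun l => (\sum_(v <- s) sinlin v l) ^+ 2) <= \sum_(i < n) (\sum_(v <- s) th v i) ^+ 2.
Proof.
have lS := coordlip_sum s coordlip_sinlin.
have := rad_covariance lS lS; rewrite rad_sum big1 => [|v _]; last exact: rad_sinlin.
rewrite mul0r subr0 => /(le_trans (ler_norm _)); exact.
Qed.

Lemma rad_sum_sinlin (s : seq T) : radmean n (fun l => \sum_(v <- s) sinlin v l) = 0.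
Proof. by rewrite rad_sum big1 // => v _; exact: rad_sinlin. Qed.

End BiasedProducts.

(** Isolates the linear term, which vanishes on averaging, so that only a second moment remains to
    be estimated. *)
Lemma expr1D_le_quadratic (R : realType) (t : R) k : `|t| <= 1 ->
  (1 + t) ^+ k <= 1 + k%:R * t + 4 ^+ k * t ^+ 2.
Proof.
rewrite ler_norml => /andP[t1 t2]; elim: k => [|k IH]; first by rewrite !expr0; have := sqr_ge0 t; lra.
rewrite exprS.
have t0 : 0 <= 1 + t by lra.
apply: le_trans (ler_wpM2l t0 IH) _.
have kb : k%:R <= 4 ^+ k :> R.
  by rewrite -natrX ler_nat ltnW // ltn_expl.
have h1 : 4 ^+ k * (t * t ^+ 2) <= 4 ^+ k * t ^+ 2.
  by rewrite ler_wpM2l ?exprn_ge0 //; have := sqr_ge0 t; nra.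
have h2 : k%:R * t ^+ 2 <= 4 ^+ k * t ^+ 2 by rewrite ler_wpM2r ?sqr_ge0.
have h3 : 0 <= 4 ^+ k * t ^+ 2 by rewrite mulr_ge0 ?sqr_ge0 ?exprn_ge0.
rewrite [4 ^+ _.+1]exprS -(natr1 k).
lra.
Qed.

(** * Tuples of vertices: splitting off the first entry, and enumerations of a set *)

Section Tuples.
Variables (T : finType) (m : nat).
Implicit Types (t : T) (g : {ffun 'I_m -> T}).

Definition fcons t g : {ffun 'I_m.+1 -> T} :=
  [ffun i => if unlift ord0 i is Some j then g j else t].

Lemma fcons0 t g : fcons t g ord0 = t.
Proof. by rewrite ffunE unlift_none. Qed.

Lemma fconsS t g j : fcons t g (lift ord0 j) = g j.
Proof. by rewrite ffunE liftK. Qed.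

Lemma sum_fcons (M : nmodType) (F : {ffun 'I_m.+1 -> T} -> M) :
  \sum_f F f = \sum_t \sum_g F (fcons t g).
Proof.
rewrite pair_big /= (reindex (fun p : T * {ffun 'I_m -> T} => fcons p.1 p.2)) //=.
exists (fun f => (f ord0, [ffun j => f (lift ord0 j)])) => [[t g] _|f _] /=.
  by congr (_, _); [exact: fcons0 | apply/ffunP => j; rewrite ffunE fconsS].
apply/ffunP => i; case: (unliftP ord0 i) => [j|] ->; first by rewrite fconsS ffunE.
by rewrite fcons0.
Qed.

Lemma imset_fcons t g : [set fcons t g i | i : 'I_m.+1] = t |: [set g i | i : 'I_m].
Proof.
apply/setP => x; rewrite in_setU1; apply/imsetP/idP => [[i _ ->]|].
  case: (unliftP ord0 i) => [j|] ->; last by rewrite fcons0 eqxx.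
  by rewrite fconsS finset.imset_f ?orbT.
by move=> /orP[/eqP ->|/imsetP[j _ ->]]; [exists ord0 => //; rewrite fcons0 | exists (lift ord0 j) => //; rewrite fconsS].
Qed.

End Tuples.

Lemma onto_injective (T : finType) m (g : {ffun 'I_m -> T}) :
  #|[set g i | i : 'I_m]| = m -> injective g.
Proof.
move=> gm i j; have /imset_injP h : #|g @: 'I_m| == #|'I_m| by rewrite gm card_ord.
exact: h.
Qed.

Lemma card_ffun_onto (T : finType) m (e : {set T}) : #|e| = m ->
  #|[set g : {ffun 'I_m -> T} | [set g i | i : 'I_m] == e]| = m`!.
Proof.
move=> em; rewrite -(ffactnn m) -[X in X ^_ _]em -[X in _ ^_ X](card_ord m) -card_inj_ffuns_on.
apply: eq_card => g; rewrite !inE; apply/eqP/andP => [ge|[/ffun_onP ge /injectiveP gi]].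
  split; first by apply/ffun_onP => i; rewrite -ge finset.imset_f.
  by apply/injectiveP; apply: onto_injective; rewrite ge.
apply/eqP; rewrite eqEcard; apply/andP; split.
  by apply/fintype.subsetP => x /imsetP[i _ ->].
by rewrite card_imset // card_ord em.
Qed.

(** * Counting in a regular uniform hypergraph, and the coefficients of [sigmaH] *)

Section Hypergraph.
Variables (V : finType) (m : nat) (E : {set {set V}}) (d : nat).
Hypotheses (uE : uniform m.+1 E) (rE : regular d E).

Lemma double_count : (m.+1 * #|E| = #|V| * d)%N.
Proof.
rewrite mulnC -sum_nat_const.
transitivity (\sum_(e in E) \sum_v (v \in e : nat))%N.
  by apply: eq_bigr => e /uE <-; rewrite -sum1_card big_mkcond /=; apply: eq_bigr => v _; case: (v \in e).
rewrite exchange_big /= -sum_nat_const; apply: eq_bigr => v _.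
rewrite -(rE v) -sum1_card -big_mkcondr /=.
by rewrite [RHS](eq_bigl (fun e => (e \in E) && (v \in e))) // => e; rewrite inE.
Qed.

(** Group the tuples by the edge they form with [v]: each of the [d] edges through [v] arises from
    the [m]! orderings of its other vertices. *)
Lemma card_link v :
  #|[set g : {ffun 'I_m -> V} | v |: [set g i | i : 'I_m] \in E]| = (m`! * d)%N.
Proof.
rewrite -sum1_card (partition_big (fun g : {ffun 'I_m -> V} => v |: [set g i | i : 'I_m])
   (mem [set e in E | v \in e])) /=; last first.
  by move=> g; rewrite !inE eqxx /= => ->.
rewrite mulnC -(rE v) -sum_nat_const; apply: eq_bigr => e; rewrite inE => /andP[eE ve].
have ev : #|e :\ v| = m by have := cardsD1 v e; rewrite ve uE //= => -[].
rewrite -(card_ffun_onto ev) -sum1_card; apply: eq_bigl => g; rewrite !inE.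
apply/andP/eqP => [[_ /eqP ge]|ge]; last by rewrite ge finset.setD1K // eE eqxx.
(* If [v] occurred in the tuple, the edge would have at most [m] vertices instead of [m.+1]. *)
rewrite -ge finset.setU1K //; apply/negP => vg.
have : #|e| = #|[set g i | i : 'I_m]|.
  by rewrite -ge; congr #|pred_of_set _|; apply/finset.setUidPr; rewrite finset.sub1set.
rewrite (uE eE) => h; have := leq_imset_card g [set: 'I_m].
have -> : g @: [set: 'I_m] = [set g i | i : 'I_m].
  by apply/setP => x; apply/imsetP/imsetP => -[y _ ->]; exists y.
by rewrite -h cardsT card_ord ltnn.
Qed.

(** The tuples counted by [card_link] avoid [v]. *)
Lemma link_bound (v : V) : (m`! * d <= #|V|.-1 ^ m)%N.
Proof.
rewrite -(card_link v).
have -> : (#|V|.-1 ^ m)%N = #|ffun_on (mem (~: [set v])) : pred {ffun 'I_m -> V}|.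
  by rewrite card_ffun_on card_ord -(cardsC [set v]) cards1.
apply: subset_leq_card; apply/fintype.subsetP => g; rewrite inE => gE.
apply/ffun_onP => i; rewrite !inE; apply/negP => /eqP gi.
have h : v |: [set g i | i : 'I_m] = [set g i | i : 'I_m].
  by apply/finset.setUidPr; rewrite finset.sub1set -gi finset.imset_f.
have := leq_imset_card g [set: 'I_m].
have -> : g @: [set: 'I_m] = [set g i | i : 'I_m].
  by apply/setP => x; apply/imsetP/imsetP => -[y _ ->]; exists y.
by rewrite -h (uE gE) cardsT card_ord ltnn.
Qed.

Section Maps.
Variable K : fieldType.

Definition qE : K := (m.+1 * #|E|)%:R / (#|V| ^ m.+1)%:R.

Definition sigma_coef (f : {ffun 'I_m.+1 -> V}) : K :=
  ([set f i | i : 'I_m.+1] \in E)%:R / (m`!)%:R - qE.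

Lemma sigmaHE (x : 'I_m.+1 -> V -> K) :
  sigmaH E x = \sum_f sigma_coef f * \prod_(i < m.+1) x i (f i).
Proof.
rewrite /sigmaH /tauH /Jmap /= big_mkcond mulr_sumr mulr_sumr -sumrB.
apply: eq_bigr => f _; rewrite /sigma_coef /qE mulrBl; congr (_ - _).
by case: ifP => _; rewrite ?mul1r ?mul0r ?mulr0.
Qed.

Lemma sigmaH_cons (x : 'I_m.+1 -> V -> K) :
  sigmaH E x = \sum_v x ord0 v * \sum_(g : {ffun 'I_m -> V}) sigma_coef (fcons v g) *
    \prod_(i < m) x (lift ord0 i) (g i).
Proof.
rewrite sigmaHE sum_fcons; apply: eq_bigr => v _; rewrite mulr_sumr; apply: eq_bigr => g _.
rewrite big_ord_recl fcons0 mulrCA; congr (_ * (_ * _)).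
by apply: eq_bigr => i _; rewrite fconsS.
Qed.

(** Every edge is the image of [m.+1]! tuples, and the normalization by [m]! leaves the factor
    [m.+1]. *)
Lemma sigmaH_diag (x : V -> K) : (m.+1)`!%:R != 0 :> K ->
  sigmaH E (fun _ : 'I_m.+1 => x) =
  (m.+1)%:R * \sum_(e in E) \prod_(v in e) x v - qE * (\sum_v x v) ^+ m.+1.
Proof.
move=> m0; rewrite /sigmaH; congr (_ - _ * _).
  rewrite /tauH /= (partition_big (fun f : {ffun 'I_m.+1 -> V} => [set f i | i : 'I_m.+1]) (mem E)) //=.
  rewrite mulr_sumr mulr_sumr; apply: eq_bigr => e eE.
  transitivity ((m`!)%:R^-1 * \sum_(f in [set f : {ffun 'I_m.+1 -> V} | [set f i | i : 'I_m.+1] == e]) \prod_(v in e) x v).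
    congr (_ * _); apply: eq_big => [f|f /andP[_ /eqP fe]].
      by rewrite inE; case: eqP => [->|]; rewrite ?andbF // andbT.
    have fi : injective f by apply: onto_injective; rewrite fe uE.
    by rewrite -fe big_imset //= => i j _ _; exact: fi.
  have f0 : (m`!)%:R != 0 :> K by apply: contra_neq m0 => h; rewrite factS natrM h mulr0.
  rewrite sumr_const card_ffun_onto ?uE // factS -[_ *+ (_ * _)]mulr_natl natrM (mulrC m.+1%:R) -mulrA.
  exact: mulKf.
rewrite /Jmap -(bigA_distr_bigA (fun (_ : 'I_m.+1) v => x v)) /=.
by rewrite prodr_const card_ord.
Qed.

End Maps.
End Hypergraph.

(** * Random signs indexed by vertices, and moments of contracted tensors *)

Section VertexSigns.
Variables (R : realType) (V : finType).

(** Transports a family on vertices to the numbered coefficients that [linsum] expects, extended by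
    0. *)
Definition vcoef (a : V -> R) (i : nat) : R :=
  oapp (fun j : 'I_#|V| => a (enum_val j)) 0 (insub i).

Lemma vcoefE (a : V -> R) (i : 'I_#|V|) : vcoef a i = a (enum_val i).
Proof. by rewrite /vcoef valK. Qed.

Lemma sum_enum_val (F : V -> R) : \sum_(i < #|V|) F (enum_val i) = \sum_v F v.
Proof.
rewrite [RHS](reindex (@enum_val V (mem V))) //=.
by apply: onW_bij; exact: enum_val_bij.
Qed.

Lemma linsum_vcoef (a : V -> R) (l : seq R) :
  linsum #|V| (vcoef a) l = \sum_v a v * l`_(enum_rank v).
Proof.
rewrite -(sum_enum_val (fun v => a v * l`_(enum_rank v))).
by apply: eq_bigr => i _; rewrite vcoefE enum_valK.
Qed.

Variable G : finType.
Implicit Type a : V -> G -> R.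

Definition contract a (l : seq R) (g : G) : R := \sum_v a v g * l`_(enum_rank v).

Lemma rad_contract_sqr a :
  radmean #|V| (fun l => \sum_g contract a l g ^+ 2) = \sum_g \sum_v a v g ^+ 2.
Proof.
rewrite rad_sum; apply: eq_bigr => g _.
rewrite (eq_rad _ (G := fun l => (0 + linsum #|V| (vcoef (a^~ g)) l) ^+ 2)); last first.
  by move=> l; rewrite add0r linsum_vcoef.
rewrite rad_sqr expr0n add0r -sum_enum_val.
by apply: eq_bigr => i _; rewrite vcoefE.
Qed.

(** Each [contract a l g] is linear in the signs, so its fourth moment is at most 3 times its
    squared second moment; Minkowski's inequality adds these bounds over [g]. *)
Lemma rad_contract_pow4 a :
  radmean #|V| (fun l => (\sum_g contract a l g ^+ 2) ^+ 2) <=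
  3 * (\sum_g \sum_v a v g ^+ 2) ^+ 2.
Proof.
elim: (index_enum G) => [|g s IH].
  rewrite big_nil (eq_rad _ (G := fun=> 0)) => [|l]; last by rewrite big_nil expr0n.
  by rewrite rad_cst expr0n mulr0.
rewrite big_cons (eq_rad _ (G := fun l => (contract a l g ^+ 2 +
  \sum_(j <- s) contract a l j ^+ 2) ^+ 2)) => [|l]; last by rewrite big_cons.
have S0 j : 0 <= \sum_v a v j ^+ 2 by apply: sumr_ge0 => v _; exact: sqr_ge0.
apply: rad_minkowski => //; first by apply: sumr_ge0.
rewrite (eq_rad _ (G := fun l => (0 + linsum #|V| (vcoef (a^~ g)) l) ^+ 4)); last first.
  by move=> l; rewrite add0r linsum_vcoef -exprM.
apply: le_trans (rad_pow4 _ _ _) _; rewrite !expr0n /= mulr0 mul0r !add0r.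
rewrite -sum_enum_val; under eq_bigr do rewrite vcoefE; exact: lexx.
Qed.

End VertexSigns.

(** * A Khintchine inequality for a sum of absolute values of multilinear forms *)

Section MixedKhintchine.
Variables (R : realType) (V I : finType).

Definition multiform m (a : {ffun 'I_m -> V} -> R) (x : 'I_m -> V -> R) : R :=
  \sum_g a g * \prod_(i < m) x i (g i).

Lemma multiform_cons m (a : {ffun 'I_m.+1 -> V} -> R) (x : 'I_m.+1 -> V -> R) :
  multiform a x = multiform (fun g => \sum_v a (fcons v g) * x ord0 v) (fun i => x (lift ord0 i)).
Proof.
rewrite /multiform sum_fcons exchange_big /=; apply: eq_bigr => g _.
rewrite mulr_suml; apply: eq_bigr => v _.
rewrite big_ord_recl fcons0 mulrA; congr (_ * _).
by apply: eq_bigr => i _; rewrite fconsS.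
Qed.

(* The signs are chosen one layer at a time; averaging a layer preserves the second
   moment and multiplies the fourth one by at most 3. *)
Lemma exists_signs m (a : I -> {ffun 'I_m -> V} -> R) (al be : R) : 0 <= al -> 0 <= be ->
  exists2 x : 'I_m -> V -> R, (forall i v, `|x i v| <= 1) &
    \sum_j (al * (\sum_g a j g ^+ 2) - be * 3 ^+ m * (\sum_g a j g ^+ 2) ^+ 2) <=
    \sum_j (al * multiform (a j) x ^+ 2 - be * multiform (a j) x ^+ 4).
Proof.
move=> al0; elim: m a be => [|m IH] a be be0.
  exists (fun _ _ => 0) => [i v|]; first by rewrite normr0.
  apply: ler_sum => j _; have [g0 hg] : exists g0 : {ffun 'I_0 -> V}, forall g, g = g0.
    have f0 : 'I_0 -> V by case.
    by exists [ffun i => f0 i] => g; apply/ffunP => -[].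
  have one (F : {ffun 'I_0 -> V} -> R) : \sum_g F g = F g0.
    by rewrite (bigD1 g0) //= big1 ?addr0 // => g; rewrite (hg g) eqxx.
  by rewrite /multiform !one big_ord0 mulr1 expr0 mulr1 -!exprM.
pose b j v g := a j (fcons v g).
pose F l := \sum_j (al * (\sum_g contract (b j) l g ^+ 2) -
   be * 3 ^+ m * (\sum_g contract (b j) l g ^+ 2) ^+ 2).
have [l hl hF] := rad_exists #|V| F.
have [x hx h] := IH (fun j g => contract (b j) l g) be be0.
exists (fun i v => if unlift ord0 i is Some k then x k v else l`_(enum_rank v)).
  by move=> i v; case: (unlift ord0 i).
apply: le_trans (_ : radmean #|V| F <= _).
  rewrite /F rad_sum; apply: ler_sum => j _; rewrite radB !radZ rad_contract_sqr.
  have -> : \sum_g a j g ^+ 2 = \sum_g \sum_v b j v g ^+ 2 by rewrite sum_fcons exchange_big.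
  rewrite lerD2l lerN2 exprSr -!mulrA ler_wpM2l // ler_wpM2l ?exprn_ge0 //.
  exact: rad_contract_pow4.
apply: le_trans hF _; apply: le_trans h _.
apply: ler_sum => j _; rewrite !multiform_cons unlift_none.
have -> : multiform (contract (b j) l) x = multiform (fun g => \sum_v a j (fcons v g) * l`_(enum_rank v))
   (fun i v => if unlift ord0 (lift ord0 i) is Some k then x k v else l`_(enum_rank v)).
  by apply: eq_bigr => g _; congr (_ * _); apply: eq_bigr => i _; rewrite liftK.
exact: lexx.
Qed.

(** With [u = al * |t|] this is [u - u ^+ 3 <= 1]. It bounds a mean absolute value below through
    second and fourth moments alone. *)
Lemma norm_ge_quartic (al t : R) : 0 <= al -> al * t ^+ 2 - al ^+ 3 * t ^+ 4 <= `|t|.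
Proof.
move=> al0; have t0 := normr_ge0 t.
have -> : t ^+ 4 = `|t| ^+ 4 by rewrite (exprM _ 2 2) -(real_normK (num_real t)) -exprM.
rewrite -(real_normK (num_real t)).
have -> : al * `|t| ^+ 2 - al ^+ 3 * `|t| ^+ 4 =
  `|t| * ((al * `|t|) - (al * `|t|) ^+ 3) by ring.
have u0 : 0 <= al * `|t| by exact: mulr_ge0.
rewrite -[leRHS]mulr1 ler_wpM2l //; move: u0; set u := al * _ => u0.
have [u1|u1] := lerP u 1; first by have := exprn_ge0 3 u0; lra.
have : u <= u ^+ 3 by rewrite -[leLHS]expr1 ler_eXn2l.
lra.
Qed.

Lemma mixed_khintchine m (a : I -> {ffun 'I_m -> V} -> R) (N : R) : 0 < N ->
  (forall j, \sum_g a j g ^+ 2 = N) ->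
  exists2 x : 'I_m -> V -> R, (forall i v, `|x i v| <= 1) &
    #|I|%:R * Num.sqrt N / 2 ^+ m.+2 <= \sum_j `|multiform (a j) x|.
Proof.
move=> N0 aN.
have s0 : 0 < Num.sqrt N by rewrite sqrtr_gt0.
(* This scale gives [k ^+ 2 * 3 ^+ m <= 1/2], so the quartic term takes away at most half of the
   quadratic one. *)
pose k : R := 2 ^- m.+1.
have k0 : 0 < k by rewrite invr_gt0 exprn_gt0.
pose al := k / Num.sqrt N.
have al0 : 0 <= al by apply: ltW; exact: divr_gt0.
have [x hx h] := exists_signs a al0 (exprn_ge0 3 al0).
exists x => //; apply: le_trans (le_trans h _); last first.
  by apply: ler_sum => j _; exact: norm_ge_quartic.
under eq_bigr do rewrite aN.
rewrite sumr_const -[leRHS]mulr_natl -mulrA ler_wpM2l //.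
have -> : al * N = k * Num.sqrt N.
  by rewrite -{1}(sqr_sqrtr (ltW N0)) /al; field; rewrite gt_eqF.
have -> : al ^+ 3 * 3 ^+ m * N ^+ 2 = k * Num.sqrt N * (k ^+ 2 * 3 ^+ m).
  by rewrite -{1}(sqr_sqrtr (ltW N0)) /al; field; rewrite gt_eqF.
have -> : 2 ^- m.+2 = k / 2 by rewrite /k [in LHS]exprS invfM mulrC.
have : k ^+ 2 * 3 ^+ m <= 2^-1.
  rewrite /k exprVn -exprM mulnC exprM (_ : 2 ^+ 2 = 4) ?expr2 -?natrM //.
  rewrite mulrC ler_pdivrMr ?exprn_gt0 // exprS.
  have : 3 ^+ m <= 4 ^+ m :> R by rewrite lerXn2r ?nnegrE //; lra.
  have : 0 <= 4 ^+ m :> R by exact: exprn_ge0.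
  lra.
have : 0 < k * Num.sqrt N by exact: mulr_gt0.
set A := k * Num.sqrt N; set B := k ^+ 2 * _ => A0 hB.
have -> : Num.sqrt N * (k / 2) = A / 2 by rewrite /A; ring.
nra.
Qed.

End MixedKhintchine.

(** * Large values of [sigmaH] as a multilinear form *)

Section MultilinearBounds.
Variables (R : realType) (V : finType) (m : nat) (E : {set {set V}}) (d : nat).
Hypotheses (uE : uniform m.+1 E) (rE : regular d E) (V0 : (0 < #|V|)%N).
Let q : R := qE m E R.

Lemma qE_regular : qE m E R = d%:R / #|V|%:R ^+ m.
Proof.
have n0 : #|V|%:R != 0 :> R by rewrite pnatr_eq0 -lt0n.
rewrite /qE (double_count uE rE) natrM natrX exprS; field.
by rewrite n0 expf_neq0.
Qed.

(** The edge indicator is idempotent, so a squared coefficient is affine in it; there are [m]! * [d]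
    tuples with indicator 1 among [n^m], and [q * n^m = d]. *)
Lemma sum_sigma_coef_sqr (v : V) :
  \sum_(g : {ffun 'I_m -> V}) sigma_coef E R (fcons v g) ^+ 2 = d%:R * ((m`!)%:R^-1 - q).
Proof.
have n0 : #|V|%:R != 0 :> R by rewrite pnatr_eq0 -lt0n.
have f0 : (m`!)%:R != 0 :> R by rewrite pnatr_eq0 -lt0n fact_gt0.
pose b (g : {ffun 'I_m -> V}) : R := (v |: [set g i | i : 'I_m] \in E)%:R.
have sb : \sum_g b g = (m`!)%:R * d%:R.
  rewrite -natrM -(card_link uE rE v) -sum1_card natr_sum /= [RHS]big_mkcond /=.
  by apply: eq_bigr => g _; rewrite /b inE; case: (_ \in E).
rewrite (eq_bigr (fun g => b g * ((m`!)%:R ^- 2 - 2 * q / (m`!)%:R) + q ^+ 2)); last first.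
  move=> g _; rewrite /sigma_coef imset_fcons -/(b g) -/q.
  by rewrite /b; case: (_ \in E) => /=; field.
rewrite big_split /= -mulr_suml sb sumr_const card_ffun card_ord -[q ^+ 2 *+ _]mulr_natr natrX.
rewrite (_ : q ^+ 2 * _ = q * d%:R); last first.
  by rewrite /q qE_regular; field; rewrite expf_neq0.
by field.
Qed.

(** Keeps the second moment of order [d], with a constant depending on [m] only. *)
Lemma sigma_gap : (1 < m)%N -> d%:R < #|V|%:R ^+ 2 / 4 :> R ->
  (m`!)%:R ^- 2 <= (m`!)%:R^-1 - q.
Proof.
move=> m1 hd; have [v _] : exists v : V, true by case/card_gt0P: V0 => v; exists v.
have n0 : 0 < #|V|%:R :> R by rewrite ltr0n.
have n1 : 1 <= #|V|%:R :> R by rewrite ler1n.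
have f0 : 0 < (m`!)%:R :> R by rewrite ltr0n fact_gt0.
have f2 : 2 <= (m`!)%:R :> R.
  by rewrite ler_nat; apply: leq_trans (fact_geq m).
suff : (m`!)%:R * q <= 1 - (m`!)%:R^-1.
  move=> h; have -> : (m`!)%:R^-1 - q = (m`!)%:R^-1 * (1 - (m`!)%:R * q).
    by field; rewrite gt_eqF.
  by rewrite expr2 invfM ler_wpM2l ?invr_ge0 ?(ltW f0) //; lra.
have q0 : 0 <= q by rewrite /q qE_regular mulr_ge0 // invr_ge0 exprn_ge0.
(* If [n <= m!], then [link_bound] gives [m! * q <= (1 - 1/n)^m <= 1 - 1/m!]. Otherwise
   [m! * q <= 1/2] is shown. *)
have [nf|fn] := leqP #|V| m`!.
  apply: le_trans (_ : 1 - #|V|%:R^-1 <= _); last first.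
    by rewrite lerD2l lerN2 lef_pV2 ?posrE // ler_nat.
  have := link_bound uE rE v; rewrite -(ler_nat R) natrM natrX => h.
  rewrite /q qE_regular mulrA ler_pdivrMr ?exprn_gt0 //; apply: le_trans h _.
  have -> : #|V|.-1%:R = #|V|%:R * (1 - #|V|%:R^-1) :> R.
    by rewrite -subn1 natrB //; field; rewrite gt_eqF.
  have u0 : 0 <= 1 - #|V|%:R^-1 :> R by rewrite subr_ge0 invf_le1.
  have u1 : 1 - #|V|%:R^-1 <= 1 :> R by rewrite gerBl invr_ge0 ltW.
  rewrite exprMn mulrC ler_wpM2r ?exprn_ge0 ?(ltW n0) // -[leRHS]expr1.
  by rewrite ler_wiXn2l // ltnW.
apply: le_trans (_ : 2^-1 <= _); last first.
  have : (m`!)%:R^-1 <= 2^-1 :> R by rewrite lef_pV2 ?posrE.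
  lra.
rewrite /q qE_regular mulrA ler_pdivrMr ?exprn_gt0 //.
(* For [m = 2] the bound on [d] suffices; for larger [m] the factor [m! < n] is absorbed by a
   further power of [n]. *)
case: m m1 f0 f2 fn => [|[|[|k]]] // _ f0 f2 fn.
  rewrite (_ : 2`! = 2%N) //; lra.
apply: le_trans (_ : #|V|%:R * (#|V|%:R ^+ 2 / 4) <= _).
  by apply: ler_pM => //; [rewrite ler_nat ltnW | exact: ltW].
have : 1 <= #|V|%:R ^+ k :> R by exact: exprn_ege1.
have : 0 <= #|V|%:R ^+ 3 :> R by rewrite exprn_ge0 ?ltW.
rewrite !exprS expr0 mulr1; nra.
Qed.

Lemma exists_multilinear_sqrt : (1 < m)%N -> (0 < d)%N -> d%:R < #|V|%:R ^+ 2 / 4 :> R ->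
  exists2 x : 'I_m.+1 -> V -> R, (forall i v, `|x i v| <= 1) &
    ((m`!)%:R * 2 ^+ m.+2)^-1 * (#|V|%:R * Num.sqrt d%:R) <= `|sigmaH E x|.
Proof.
move=> m1 d0 hd; have gap := sigma_gap m1 hd.
have f0 : 0 < (m`!)%:R :> R by rewrite ltr0n fact_gt0.
have N0 : 0 < d%:R * ((m`!)%:R^-1 - q).
  by rewrite mulr_gt0 ?ltr0n //; apply: lt_le_trans gap; rewrite invr_gt0 exprn_gt0.
have [x hx h] := mixed_khintchine N0 sum_sigma_coef_sqr.
pose F v := multiform (fun g => sigma_coef E R (fcons v g)) x.
(* The first variable is the sign of the form left by the others, so [sigmaH] becomes the sum of the
   absolute values of [F v]. *)
exists (fun i v => if unlift ord0 i is Some k then x k v else Num.sg (F v)).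
  move=> i v; case: (unlift ord0 i) => //; rewrite normr_sg; by case: (F v == 0).
rewrite sigmaH_cons; apply: le_trans (ler_norm _).
have -> : \sum_v (if unlift ord0 ord0 is Some k then x k v else Num.sg (F v)) *
   (\sum_(g : {ffun 'I_m -> V}) sigma_coef E R (fcons v g) * \prod_(i < m)
   (if unlift ord0 (lift ord0 i) is Some k then x k (g i) else Num.sg (F (g i)))) = \sum_v `|F v|.
  apply: eq_bigr => v _; rewrite unlift_none normrEsg; congr (_ * _).
  by apply: eq_bigr => g _; congr (_ * _); apply: eq_bigr => i _; rewrite liftK.
have key : Num.sqrt d%:R / (m`!)%:R <= Num.sqrt (d%:R * ((m`!)%:R^-1 - q)).
  rewrite sqrtrM // ler_wpM2l ?sqrtr_ge0 //.
  apply: le_trans (_ : Num.sqrt ((m`!)%:R ^- 2) <= _); last by rewrite ler_wsqrtr.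
  by rewrite -exprVn sqrtr_sqr ger0_norm // invr_ge0 ltW.
apply: le_trans h.
have -> : ((m`!)%:R * 2 ^+ m.+2)^-1 * (#|V|%:R * Num.sqrt d%:R) =
   #|V|%:R * (Num.sqrt d%:R / (m`!)%:R) / 2 ^+ m.+2 :> R.
  by field; rewrite expf_neq0 ?gt_eqF.
by rewrite ler_wpM2r ?invr_ge0 ?exprn_ge0 // ler_wpM2l.
Qed.

(** Polarizes the second-moment formula for linear forms. *)
Lemma rad_signs (u v : V) :
  radmean #|V| (fun l => l`_(enum_rank u) * l`_(enum_rank v)) = (u == v)%:R :> R.
Proof.
pose dlt (u w : V) : R := (w == u)%:R.
have s1 w (l : seq R) : \sum_z dlt w z * l`_(enum_rank z) = l`_(enum_rank w).
  by rewrite (bigD1 w) //= /dlt eqxx mul1r big1 ?addr0 // => z /negPf ->; rewrite mul0r.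
have e2 (a : V -> R) : radmean #|V| (fun l => (\sum_z a z * l`_(enum_rank z)) ^+ 2) = \sum_z a z ^+ 2.
  rewrite (eq_rad _ (G := fun l => (0 + linsum #|V| (vcoef a) l) ^+ 2)); last first.
    by move=> l; rewrite add0r linsum_vcoef.
  rewrite rad_sqr expr0n add0r -(sum_enum_val (fun z => a z ^+ 2)).
  by apply: eq_bigr => i _; rewrite vcoefE.
rewrite (eq_rad _ (G := fun l => 2^-1 * ((\sum_z (dlt u z + dlt v z) * l`_(enum_rank z)) ^+ 2 -
   ((\sum_z dlt u z * l`_(enum_rank z)) ^+ 2 + (\sum_z dlt v z * l`_(enum_rank z)) ^+ 2)))); last first.
  move=> l; under eq_bigr do rewrite mulrDl.
  by rewrite big_split /= !s1; field.
rewrite radZ radB radD !e2 -big_split /= -sumrB mulr_sumr (bigD1 u) //= big1.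
  by rewrite addr0 /dlt eqxx; case: (u == v) => /=; field.
by move=> z /negPf zu; rewrite /dlt zu /=; field.
Qed.

End MultilinearBounds.

(* Averaged over signs, only the tuples with two equal first entries contribute, and
   none of those is an edge. *)
Lemma exists_multilinear_degree (R : realType) (V : finType) (m : nat) (E : {set {set V}}) (d : nat) :
  uniform m.+2 E -> regular d E -> (0 < #|V|)%N ->
  exists2 x : 'I_m.+2 -> V -> R, (forall i v, `|x i v| <= 1) & d%:R <= `|sigmaH E x|.
Proof.
move=> uE rE V0.
pose i1 : 'I_m.+2 := lift ord0 ord0.
pose X (l : seq R) (i : 'I_m.+2) (v : V) : R :=
  if (i == ord0) || (i == i1) then l`_(enum_rank v) else 1.
(* The mean of [sigmaH] is [- d], so its negative is the quantity to make large. *)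
have [l hl h] := rad_exists #|V| (fun l => -1 * sigmaH E (X l)).
exists (X l) => [i v|]; first by rewrite /X; case: ifP => _; rewrite ?normr1.
apply: le_trans (_ : -1 * sigmaH E (X l) <= _); last first.
  by rewrite mulN1r -normrN ler_norm.
apply: le_trans h; rewrite radZ.
have n0 : #|V|%:R != 0 :> R by rewrite pnatr_eq0 -lt0n.
have prodX (l' : seq R) (f : {ffun 'I_m.+2 -> V}) :
    \prod_(i < m.+2) X l' i (f i) = l'`_(enum_rank (f ord0)) * l'`_(enum_rank (f i1)).
  by rewrite !big_ord_recl /= big1 ?mulr1 // => i _; rewrite /X; case: ifP => //.
rewrite (eq_rad _ (G := fun l => \sum_f sigma_coef E R f *
   (l`_(enum_rank (f ord0)) * l`_(enum_rank (f i1))))); last first.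
  by move=> l'; rewrite sigmaHE; apply: eq_bigr => f _; rewrite prodX.
rewrite rad_sum; under eq_bigr do rewrite radZ rad_signs.
rewrite sum_fcons exchange_big /=.
rewrite (eq_bigr (fun=> - qE m.+1 E R)) => [|g _].
  rewrite sumr_const card_ffun card_ord -[(- _) *+ _]mulr_natr natrX (qE_regular R uE rE V0).
  rewrite mulN1r mulNr opprK divfK // expf_neq0 //.
rewrite (bigD1 (g ord0)) //= big1 => [|v vg]; last first.
  by rewrite fcons0 fconsS (negPf vg) mulr0.
rewrite addr0 fcons0 fconsS eqxx mulr1 /sigma_coef imset_fcons.
rewrite (_ : (_ \in E) = false) ?mul0r ?add0r //; apply/negP => /uE.
have -> : g ord0 |: [set g i | i : 'I_m.+1] = [set g i | i : 'I_m.+1].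
  by apply/finset.setUidPr; rewrite finset.sub1set finset.imset_f.
have := leq_imset_card g 'I_m.+1; rewrite card_ord => hc hc2.
by rewrite hc2 ltnn in hc.
Qed.

(** * Positive values of [sigmaH] on the diagonal *)

Section PositiveValue.
Variables (R : realType) (V : finType) (m : nat) (E : {set {set V}}) (d : nat).
Hypotheses (uE : uniform m.+1 E) (rE : regular d E) (V0 : (0 < #|V|)%N) (d0 : (0 < d)%N).

Definition adjacent (u w : V) : bool := [exists e in E, (u \in e) && (w \in e)].

Lemma card_neighbours (u : V) : (#|[set w | adjacent u w & w != u]| <= m * d)%N.
Proof.
apply: leq_trans (_ : #|\bigcup_(e in [set e in E | u \in e]) (e :\ u)| <= _)%N.
  apply: subset_leq_card; apply/fintype.subsetP => w; rewrite inE => /andP[].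
  move=> /existsP[e /and3P[eE ue we]] wu; apply/finset.bigcupP; exists e.
    by rewrite inE eE ue.
  by rewrite !inE wu.
apply: leq_trans (_ : \sum_(e in [set e in E | u \in e]) #|e :\ u| <= _)%N.
  elim/big_rec2: _ => [|e k s _ ks]; first by rewrite cards0.
  by apply: leq_trans (leq_card_setU _ _) _; rewrite leq_add2l.
rewrite (eq_bigr (fun=> m)) => [|e]; last first.
  by rewrite inE => /andP[eE ue]; have := cardsD1 u e; rewrite ue uE // => -[].
by rewrite sum_nat_const rE mulnC.
Qed.

Variable eta : R.
Hypotheses (eta0 : 0 < eta) (eta1 : m%:R * eta ^+ 2 <= 4^-1) (eta2 : eta <= 2^-1).
Let s : R := Num.sqrt d%:R.
Let s1 : 1 <= s. Proof. by rewrite -sqrtr1 ler_wsqrtr // ler1n. Qed.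
Let s0 : 0 < s. Proof. exact: lt_le_trans s1. Qed.
Let ss : s ^+ 2 = d%:R. Proof. by rewrite sqr_sqrtr. Qed.

(** The coefficient of the sign at [w] in L_u. The scale [1 / s] keeps the sum of squares bounded,
    as [m * d * (eta / s) ^+ 2 = m * eta ^+ 2]. The diagonal is tested first because [adjacent]
    holds there for vertices on an edge. *)
Definition weight (u w : V) : R :=
  if w == u then 2^-1 else if adjacent u w then eta / s else 0.

Let weight_itv u w : 0 <= weight u w <= 2^-1.
Proof.
rewrite /weight; case: ifP => _; first by lra.
case: ifP => _; last by lra.
by rewrite divr_ge0 ?(ltW eta0) ?(ltW s0) //= ler_pdivrMr //; apply: le_trans eta2 _; rewrite ler_peMr.
Qed.

Let weightC u w : weight u w = weight w u.
Proof.
rewrite /weight eq_sym; case: ifP => // _; congr (if _ then _ else _).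
by apply: eq_existsb => e; rewrite [(u \in e) && _]andbC.
Qed.

(** Used with the square for the norms of the coefficient vectors, and with the identity for their
    entry sums. *)
Lemma sum_weight_le (F : R -> R) (u : V) : F 0 = 0 -> 0 <= F (eta / s) ->
  \sum_w F (weight u w) <= F 2^-1 + m%:R * d%:R * F (eta / s).
Proof.
move=> F0 Fe; rewrite (bigD1 u) //= /weight eqxx lerD2l.
rewrite (bigID (adjacent u)) /= [X in _ + X]big1 ?addr0; last first.
  by move=> w /andP[/negPf -> /negPf ->].
rewrite (eq_bigr (fun=> F (eta / s))) => [|w /andP[/negPf -> ->] //].
rewrite sumr_const -[leLHS]mulr_natl ler_wpM2r // -natrM ler_nat.
apply: leq_trans (card_neighbours u); apply: subset_leq_card; apply/fintype.subsetP => w.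
by rewrite !inE => /andP[-> ->].
Qed.

Let th (v : V) : nat -> R := vcoef (weight v).

Let th_itv v i : 0 <= th v i <= 2^-1.
Proof. by rewrite /th /vcoef; case: insubP => //= *; lra. Qed.

Let sum_th (F : R -> R) v : \sum_(i < #|V|) F (th v i) = \sum_w F (weight v w).
Proof. by rewrite -sum_enum_val; apply: eq_bigr => i _; rewrite /th vcoefE. Qed.

Let th_sqr v : \sum_(i < #|V|) th v i ^+ 2 <= 2^-1.
Proof.
rewrite (sum_th (fun t => t ^+ 2)).
apply: le_trans (@sum_weight_le (fun t => t ^+ 2) v _ _) _.
- by rewrite expr0n.
- exact: sqr_ge0.
- rewrite (_ : m%:R * d%:R * _ = m%:R * eta ^+ 2); first by move: eta1; lra.
  by rewrite -ss; field; rewrite gt_eqF.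
Qed.

(** The term [w = u] of the Gram sum is already [1/2 * (eta / s)]. *)
Let rho_adjacent u v : u != v -> adjacent u v -> eta / (2 * s) <= rho #|V| th u v.
Proof.
move=> uv auv; rewrite /rho.
have -> : \sum_(i < #|V|) th u i * th v i = \sum_w weight u w * weight v w.
  by rewrite -(sum_enum_val (fun w => weight u w * weight v w)); apply: eq_bigr => i _; rewrite /th !vcoefE.
rewrite (bigD1 u) //= [weight v u]weightC /weight eqxx eq_sym (negPf uv) auv.
rewrite (_ : 2^-1 * _ = eta / (2 * s)); last by rewrite invfM mulrCA.
rewrite lerDl; apply: sumr_ge0 => w _; apply: mulr_ge0; last by have /andP[] := weight_itv v w.
by have /andP[] := weight_itv u w.
Qed.

Let rad_sqr_sum : radmean #|V| (fun l => (\sum_v sinlin #|V| th v l) ^+ 2) <=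
  #|V|%:R * (2^-1 + m%:R * eta * s) ^+ 2.
Proof.
apply: le_trans (rad_sqr_sum_sinlin #|V| th_itv (index_enum V)) _.
rewrite mulr_natl -[X in _ *+ X]card_ord -sumr_const; apply: ler_sum => i _.
rewrite lerXn2r ?nnegrE //.
- by apply: sumr_ge0 => v _; have /andP[] := th_itv v i.
- by rewrite addr_ge0 // !mulr_ge0 // ltW.
(* By symmetry of [weight] the column sum is a row sum. *)
rewrite (eq_bigr (weight (enum_val i))) => [|v _]; last by rewrite /th vcoefE weightC.
apply: le_trans (@sum_weight_le id (enum_val i) _ _) _ => //.
  by rewrite divr_ge0 ?ltW.
rewrite (_ : m%:R * d%:R * _ = m%:R * eta * s) //=.
by rewrite -ss; field; rewrite gt_eqF.
Qed.

Lemma exists_positive_value (dl : R) (n : R := #|V|%:R) : (0 < m)%N ->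
  dl = 32^-1 * 4 ^- m.+1 ->
  128 * 4 ^+ m.+1 * s <= n * eta -> 512 * 4 ^+ m.+1 * m%:R ^+ 2 * eta * s ^+ 3 <= n ->
  exists2 x : V -> R, (forall v, `|x v| <= 2) &
    dl ^+ 2 * eta / 128 * (n * s) <= sigmaH E (fun _ : 'I_m.+1 => x).
Proof.
move=> m0 dlE hA hB.
have n0 : 0 < n by rewrite ltr0n.
have p0 : 0 < 4 ^+ m.+1 :> R by exact: exprn_gt0.
have p1 : 1 <= 4 ^+ m.+1 :> R by apply: exprn_ege1; lra.
have dl_itv : 0 <= dl <= 1.
  rewrite dlE mulr_ge0 ?invr_ge0 ?exprn_ge0 //=.
  by apply: mulr_ile1; rewrite ?invr_ge0 ?exprn_ge0 // ?invf_le1 //; lra.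
have /andP[dl0 dl1] := dl_itv.
pose y v l := sinlin #|V| th v l.
pose x l v := 1 + dl * y v l.
pose Z l := \sum_v y v l.
have [l _ h] := rad_exists #|V| (fun l => sigmaH E (fun _ : 'I_m.+1 => x l)).
exists (x l) => [v|].
  have := norm_sin_le1 (linsum #|V| (th v) l); rewrite -/(sinlin _ _ _ _) -/(y v l).
  by rewrite /x !ler_norml => /andP[? ?]; apply/andP; split; nra.
apply: le_trans h.
have f0 : (m.+1)`!%:R != 0 :> R by rewrite pnatr_eq0 -lt0n fact_gt0.
pose g := eta / (2 * s).
have g0 : 0 <= g by rewrite divr_ge0 ?mulr_ge0 // ltW.
pose q := qE m E R.
have rEn : m.+1%:R * #|E|%:R = n * d%:R :> R by rewrite -!natrM (double_count uE rE).
have qn : q * n ^+ m.+1 = n * d%:R.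
  rewrite /q (qE_regular R uE rE V0) exprS; field.
  by rewrite expf_neq0 // gt_eqF.
have q0 : 0 <= q by rewrite /q (qE_regular R uE rE V0) divr_ge0 ?exprn_ge0.
have Zn l' : `|dl * Z l' / n| <= 1.
  rewrite normrM normfV (ger0_norm (ltW n0)) ler_pdivrMr // mul1r normrM (ger0_norm dl0).
  rewrite -[leRHS]mul1r; apply: ler_pM => //.
  apply: le_trans (ler_norm_sum _ _ _) _.
  rewrite /n -sum1_card natr_sum; apply: ler_sum => v _; exact: norm_sin_le1.
have sumx l' : \sum_v x l' v = n * (1 + dl * Z l' / n).
  rewrite /x big_split /= sumr_const -mulr_sumr -/(Z l') -/n; field.
  by rewrite gt_eqF.
(* The power of the entry sum is replaced by its quadratic majorant in [Z], whose linear term has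
   mean 0. *)
apply: le_trans (_ : radmean #|V| (fun l => m.+1%:R * (\sum_(e in E) biased_prod #|V| th dl (enum e) l)
   - (q * n ^+ m.+1) * (1 + m.+1%:R * (dl / n) * Z l + 4 ^+ m.+1 * (dl / n) ^+ 2 * Z l ^+ 2)) <= _).
  rewrite radB !radZ rad_sum !radD !radZ rad_cst /Z rad_sum_sinlin.
  have hE : \sum_(e in E) (1 + dl ^+ 2 / 32 * g) <=
      \sum_(e in E) radmean #|V| (biased_prod #|V| th dl (enum e)).
    apply: ler_sum => e eE; have se : size (enum e) = m.+1 by rewrite -cardE uE.
    apply: rad_biased_prod_ge => //.
    (* [dl] is chosen so that [dl * 4 ^+ m.+1] equals the threshold 1/32. *)
    - by rewrite se dlE mulrAC -mulrA mulfV ?mulr1 // gt_eqF.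
    - apply: (@sub_in_pairwise _ (mem e) [rel u v | u != v]) => /=.
      + move=> u v ue ve uv; apply: rho_adjacent => //.
        by apply/existsP; exists e; rewrite eE ue ve.
      + by apply/allP => v; rewrite mem_enum.
      + by rewrite -uniq_pairwise enum_uniq.
    - by rewrite se.
  rewrite sumr_const -[X in X <= _]mulr_natl in hE.
  have hE' := ler_wpM2l (ler0n R m.+1) hE.
  rewrite mulrA rEn in hE'.
  apply: le_trans (lerB hE' (ler_wpM2l _ (lerD (lexx _) (ler_wpM2l _ rad_sqr_sum)))).
  - rewrite qn mulr0 addr0 /g -ss -/n.
    set P := 4 ^+ m.+1 in p0 p1 hA hB *.
    (* Both parts have constant term [n * d]; these cancel and a factor [dl ^+ 2] comes out. *)
    have -> : n * s ^+ 2 * (1 + dl ^+ 2 / 32 * (eta / (2 * s))) -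
        n * s ^+ 2 * (1 + P * (dl / n) ^+ 2 * (n * (2^-1 + m%:R * eta * s) ^+ 2)) =
        dl ^+ 2 * (n * s * eta / 64 - P * s ^+ 2 * (2^-1 + m%:R * eta * s) ^+ 2).
      by field; rewrite !gt_eqF.
    have -> : dl ^+ 2 * eta / 128 * (n * s) = dl ^+ 2 * (n * s * eta / 128) by field.
    rewrite ler_wpM2l ?sqr_ge0 //.
    (* By [h3] the loss has two parts. Through [h1] and [h2] each is at most [n * s * eta / 256], so
       half of the gain [n * s * eta / 64] survives. *)
    have h1 : P * s * s <= n * eta / 128 * s by rewrite ler_wpM2r ?(ltW s0) //; lra.
    have h2 : P * m%:R ^+ 2 * eta * s ^+ 3 * (eta * s) <= n / 512 * (eta * s).
      by rewrite ler_wpM2r //; [rewrite mulr_ge0 // ltW | lra].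
    have h3 : (2^-1 + m%:R * eta * s) ^+ 2 <= 2^-1 + 2 * (m%:R * eta * s) ^+ 2.
      by have := sqr_ge0 (2^-1 - m%:R * eta * s); rewrite !expr2; lra.
    have h4 : P * s ^+ 2 * (2^-1 + m%:R * eta * s) ^+ 2 <=
        P * s ^+ 2 * (2^-1 + 2 * (m%:R * eta * s) ^+ 2).
      by rewrite ler_wpM2l // mulr_ge0 ?sqr_ge0 // ltW.
    lra.
  - by rewrite mulr_ge0 // exprn_ge0 // ltW.
  - by rewrite mulr_ge0 ?sqr_ge0 // ltW.
apply: le_rad => l'; rewrite (sigmaH_diag uE) // sumx -/q.
apply: lerB.
  rewrite ler_wpM2l //; apply: ler_sum => e _.
  by rewrite /biased_prod big_enum.
rewrite [(n * _) ^+ _]exprMn [q * (_ * _)]mulrA ler_wpM2l ?mulr_ge0 ?exprn_ge0 ?(ltW n0) //.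
apply: le_trans (expr1D_le_quadratic m.+1 (Zn l')) _.
by rewrite le_eqVlt; apply/orP; left; apply/eqP; field; rewrite gt_eqF.
Qed.

End PositiveValue.

(** Two entries -1/2 and [m.+1] entries [1 / m.+1] on [e] have sum 0, which removes the [J] term,
    and positive product. Any other edge has a vertex outside [e], where the vector vanishes. *)
Lemma exists_positive_small (R : realType) (V : finType) (m : nat) (E : {set {set V}}) (e : {set V}) :
  uniform m.+3 E -> e \in E ->
  exists2 x : V -> R, (forall v, `|x v| <= 2) &
    4^-1 * (m.+1)%:R ^- m.+1 <= sigmaH E (fun _ : 'I_m.+3 => x).
Proof.
move=> uE eE; have ce := uE _ eE.
have [a [b [ae be ab]]] : exists a b, [/\ a \in e, b \in e & b != a].
  have /card_gt0P[a ae] : (0 < #|e|)%N by rewrite ce.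
  have /card_gt0P[b] : (0 < #|e :\ a|)%N.
    by have := cardsD1 a e; rewrite ae ce; lia.
  by rewrite !inE => /andP[ba be]; exists a, b.
pose h : R := (m.+1)%:R^-1.
have m0 : m.+1%:R != 0 :> R by rewrite pnatr_eq0.
pose x v : R := if v \in e then (if (v == a) || (v == b) then - 2^-1 else h) else 0.
have c2 : #|e :\ a :\ b| = m.+1.
  have := cardsD1 a e; have := cardsD1 b (e :\ a).
  by rewrite !inE ab ae be ce /=; lia.
have h0 : 0 <= h by rewrite invr_ge0.
have xr v : v \in e :\ a :\ b -> x v = h.
  by rewrite !inE /x => /and3P[/negPf -> /negPf -> ->].
have xe : \sum_v x v = 0.
  rewrite (bigID (mem e)) /= [X in _ + X]big1 ?addr0; last by move=> v /negPf ve; rewrite /x ve.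
  rewrite (big_setD1 a) //= (big_setD1 b) /=; last by rewrite !inE ab be.
  rewrite (eq_bigr (fun=> h)) => [|v /xr //]; rewrite sumr_const c2 /x ae be !eqxx orbT /=.
  by rewrite -mulr_natl /h; field.
exists x => [v|].
  rewrite /x; case: ifP => _; last by rewrite normr0.
  case: ifP => _; first by rewrite normrN ger0_norm //; lra.
  rewrite ger0_norm // /h; apply: le_trans (_ : 1 <= _); last by lra.
  by rewrite invf_le1 ?ltr0n // ler1n.
rewrite (sigmaH_diag uE) ?pnatr_eq0 -?lt0n ?fact_gt0 // xe expr0n mulr0 subr0.
have xprod : \prod_(v in e) x v = 4^-1 * h ^+ m.+1.
  rewrite (big_setD1 a) //= (big_setD1 b) /=; last by rewrite !inE ab be.
  rewrite (eq_bigr (fun=> h)) => [|v /xr //]; rewrite prodr_const c2 /x ae be !eqxx orbT /=.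
  by rewrite mulrA; congr (_ * _); field.
rewrite (bigD1 e) //= [X in _ + X]big1 => [|f /andP[fE fe]]; last first.
  have /fintype.subsetPn[v vf ve] : ~~ (f \subset e).
    by apply/negP => fs; move: fe; rewrite finset.eqEcard fs ce (uE _ fE) leqnn.
  by rewrite (bigD1 v) //= /x (negPf ve) mul0r.
rewrite addr0 xprod /h exprVn.
set A := _ * _; have A0 : 0 <= A by rewrite mulr_ge0 // invr_ge0 exprn_ge0.
by rewrite ler_peMl // ler1n.
Qed.

(** * Finiteness of the suprema and normalization in l^p *)

Section Norms.
Variables (R : realType) (V : finType) (p : R).
Hypothesis p1 : 1 <= p.
Let p0 : 0 < p. Proof. by apply: lt_le_trans p1. Qed.
Let n : R := #|V|%:R.
Local Notation normc := ComplexField.Normc.normc.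

Lemma normc_ge0 (z : R[i]) : 0 <= normc z.
Proof. by case: z => a b; rewrite /= sqrtr_ge0. Qed.

Lemma normc_real (x : R) : normc (x%:C)%C = `|x|.
Proof. by rewrite /= expr0n addr0 sqrtr_sqr. Qed.

Lemma normc_sum_le (I : Type) (s : seq I) (F : I -> R[i]) :
  normc (\sum_(i <- s) F i) <= \sum_(i <- s) normc (F i).
Proof.
elim/big_rec2: _ => [|i z w _ h]; first by rewrite ComplexField.Normc.normc0.
by apply: le_trans (le_normcD _ _) _; rewrite lerD2l.
Qed.

Lemma normc_prod (I : Type) (s : seq I) (F : I -> R[i]) :
  normc (\prod_(i <- s) F i) = \prod_(i <- s) normc (F i).
Proof.
elim/big_rec2: _ => [|i z w _ <-]; first by rewrite ComplexField.Normc.normc1.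
by rewrite ComplexField.Normc.normcM.
Qed.

Lemma le1_of_powR_sum (f : V -> R) (v : V) : (forall v, 0 <= f v) ->
  (\sum_v f v `^ p) `^ p^-1 = 1 -> f v <= 1.
Proof.
move=> f0 h.
have S0 : 0 <= \sum_v f v `^ p by apply: sumr_ge0 => w _; exact: powR_ge0.
have S1 : \sum_v f v `^ p = 1.
  have := congr1 (fun t => t `^ p) h; rewrite -powRrM mulVf ?gt_eqF // powRr1 // powR1.
  exact.
have h1 : f v `^ p <= 1.
  by rewrite -S1 (bigD1 v) //= lerDl sumr_ge0 // => w _; exact: powR_ge0.
have : (f v `^ p) `^ p^-1 <= 1 `^ p^-1.
  by apply: ge0_ler_powR; rewrite ?nnegrE ?invr_ge0 ?powR_ge0 // ltW.
by rewrite powR1 -powRrM mulfV ?gt_eqF // powRr1.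
Qed.

Lemma lpnormRZ (c : R) (x : V -> R) : 0 <= c ->
  lpnormR p (fun v => c * x v) = c * lpnormR p x.
Proof.
move=> c0; rewrite /lpnormR.
under eq_bigr do rewrite normrM (ger0_norm c0) powRM //.
have S0 : 0 <= \sum_v `|x v| `^ p by apply: sumr_ge0 => v _; exact: powR_ge0.
by rewrite -mulr_sumr powRM ?powR_ge0 // -powRrM mulfV ?gt_eqF // powRr1.
Qed.

Lemma lpnormR_le (x : V -> R) : (forall v, `|x v| <= 2) -> lpnormR p x <= 2 * n `^ p^-1.
Proof.
move=> hx; rewrite /lpnormR.
apply: le_trans (_ : (2 `^ p * n) `^ p^-1 <= _); last first.
  rewrite powRM ?powR_ge0 ?ler0n // -powRrM mulfV ?gt_eqF // powRr1 //.
apply: ge0_ler_powR; rewrite ?nnegrE ?invr_ge0 ?(ltW p0) //.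
- by apply: sumr_ge0 => v _; exact: powR_ge0.
- by rewrite mulr_ge0 ?powR_ge0.
rewrite mulrC mulr_natl -sumr_const; apply: ler_sum => v _.
by apply: ge0_ler_powR; rewrite ?nnegrE ?(ltW p0).
Qed.

Lemma lpnormR_gt0 (x : V -> R) (v : V) : x v != 0 -> 0 < lpnormR p x.
Proof.
move=> xv; apply: powR_gt0; rewrite (bigD1 v) //=; apply: ltr_pwDl.
  by rewrite powR_gt0 // normr_gt0.
by apply: sumr_ge0 => w _; exact: powR_ge0.
Qed.

Lemma lpnormC_real (x : V -> R) : lpnormC p (fun v => (x v)%:C%C) = lpnormR p x.
Proof. by rewrite /lpnormC; under eq_bigr do rewrite normc_real. Qed.

Variables (m : nat) (E : {set {set V}}).

Lemma sigmaHZ (K : fieldType) (c : 'I_m.+1 -> K) (x : 'I_m.+1 -> V -> K) :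
  sigmaH E (fun i v => c i * x i v) = \prod_i c i * sigmaH E x.
Proof.
rewrite !sigmaHE mulr_sumr; apply: eq_bigr => f _.
by rewrite big_split /= mulrCA.
Qed.

Lemma sigmaH_eq0 (K : fieldType) (x : 'I_m.+1 -> V -> K) i : (forall v, x i v = 0) -> sigmaH E x = 0.
Proof.
move=> xi; rewrite sigmaHE big1 // => f _.
by rewrite (bigD1 i) //= xi mul0r mulr0.
Qed.

Lemma sigmaH_real (x : 'I_m.+1 -> V -> R) :
  sigmaH E (fun i v => (x i v)%:C%C) = (sigmaH E x)%:C%C.
Proof.
rewrite !sigmaHE rmorph_sum /=; apply: eq_bigr => f _; rewrite rmorphM rmorph_prod /=; congr (_ * _).
rewrite /sigma_coef /qE rmorphB !rmorphM /= !fmorphV !rmorph_nat.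
by [].
Qed.

Lemma normc_sigmaH_le (x : 'I_m.+1 -> V -> R[i]) : (forall i v, normc (x i v) <= 1) ->
  normc (sigmaH E x) <= \sum_(f : {ffun 'I_m.+1 -> V}) normc (sigma_coef E R[i] f).
Proof.
move=> hx; rewrite sigmaHE; apply: le_trans (normc_sum_le _ _) _; apply: ler_sum => f _.
rewrite ComplexField.Normc.normcM normc_prod ler_piMr ?normc_ge0 //.
by apply: prodr_ile1 => i _; rewrite normc_ge0 hx.
Qed.

(** Unit vectors have entries of modulus at most 1, so the total modulus of the coefficients bounds
    every value. On an unbounded set [sup] would be the default 0. *)
Lemma ubound_mu : has_ubound [set ComplexField.Normc.normc (sigmaH E x)
   | x in [set x : 'I_m.+1 -> V -> R[i] | forall i, lpnormC p (x i) = 1]]%classic.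
Proof.
exists (\sum_(f : {ffun 'I_m.+1 -> V}) normc (sigma_coef E R[i] f)) => _ [x hx <-].
apply: normc_sigmaH_le => i v; apply: (le1_of_powR_sum (f := fun v => normc (x i v))).
  by move=> w; exact: normc_ge0.
exact: hx.
Qed.

Lemma ubound_lambda2 : has_ubound [set sigmaH E (fun _ : 'I_m.+1 => x) |
   x in [set x : V -> R | lpnormR p x = 1]]%classic.
Proof.
exists (\sum_(f : {ffun 'I_m.+1 -> V}) normc (sigma_coef E R[i] f)) => _ [x hx <-].
apply: le_trans (_ : normc (sigmaH E (fun _ : 'I_m.+1 => x))%:C%C <= _).
  by rewrite normc_real ler_norm.
rewrite -sigmaH_real; apply: normc_sigmaH_le => i v; rewrite normc_real.
by apply: (le1_of_powR_sum (f := fun v => `|x v|)).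
Qed.

Let expn_norm : (n `^ p^-1) ^+ m.+1 = n `^ (m.+1%:R / p).
Proof. by rewrite -powR_mulrn ?powR_ge0 // -powRrM mulrC. Qed.

(** Turns division by a product of norms, each at most [2 * n^(1/p)], into the factor [n^(-r/p)] at
    the price of [2 ^+ m.+1]. *)
Lemma scale_bound (B N : R) : (0 < #|V|)%N -> 0 <= B -> 0 < N ->
  N <= (2 * n `^ p^-1) ^+ m.+1 -> B / 2 ^+ m.+1 * n `^ (- (m.+1%:R / p)) <= B / N.
Proof.
move=> V0 B0 N0 hN; rewrite powRN -expn_norm -mulrA -invfM -exprMn ler_wpM2l //.
have n0 : 0 < n by rewrite ltr0n.
by rewrite lef_pV2 ?posrE // exprn_gt0 // mulr_gt0 // powR_gt0.
Qed.

Lemma lambda2_ge (x : V -> R) (B : R) : (0 < #|V|)%N -> (forall v, `|x v| <= 2) -> 0 < B ->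
  B <= sigmaH E (fun _ : 'I_m.+1 => x) ->
  B / 2 ^+ m.+1 * n `^ (- (m.+1%:R / p)) <= lambda2 m.+1 E p.
Proof.
move=> V0 hx B0 hB.
(* The value is positive, so the vector is nonzero and can be normalized. *)
have [v xv] : exists v, x v != 0.
  apply/existsP; apply: contraTT hB => /existsPn h.
  by rewrite (sigmaH_eq0 (i := ord0)) -?ltNge // => v; have := h v; rewrite negbK => /eqP.
have N0 := lpnormR_gt0 xv.
set N := lpnormR p x in N0.
have hN : N ^+ m.+1 <= (2 * n `^ p^-1) ^+ m.+1.
  rewrite lerXn2r ?nnegrE ?(ltW N0) ?mulr_ge0 ?powR_ge0 //; exact: lpnormR_le.
apply: le_trans (scale_bound V0 (ltW B0) (exprn_gt0 m.+1 N0) hN) _.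
apply: le_trans (_ : sigmaH E (fun _ : 'I_m.+1 => fun v => N^-1 * x v) <= _).
  rewrite (sigmaHZ (fun=> N^-1) (fun=> x)) prodr_const card_ord exprVn [leRHS]mulrC.
  by rewrite ler_wpM2r // invr_ge0 exprn_ge0 // ltW.
apply: (ub_le_sup ubound_lambda2); exists (fun v => N^-1 * x v) => //=.
by rewrite lpnormRZ ?invr_ge0 ?(ltW N0) // mulVf ?gt_eqF.
Qed.

Lemma mu_ge (x : 'I_m.+1 -> V -> R) (B : R) : (0 < #|V|)%N -> (forall i v, `|x i v| <= 2) -> 0 < B ->
  B <= `|sigmaH E x| ->
  B / 2 ^+ m.+1 * n `^ (- (m.+1%:R / p)) <= mu m.+1 E p.
Proof.
move=> V0 hx B0 hB.
pose N i := lpnormR p (x i).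
have N0 i : 0 < N i.
  have [v xv] : exists v, x i v != 0.
    apply/existsP; apply: contraTT hB => /existsPn h.
    by rewrite (sigmaH_eq0 (i := i)) ?normr0 -?ltNge // => v; have := h v; rewrite negbK => /eqP.
  exact: lpnormR_gt0 xv.
have hN : \prod_i N i <= (2 * n `^ p^-1) ^+ m.+1.
  rewrite -[X in _ ^+ X]card_ord -prodr_const; apply: ler_prod => i _.
  by rewrite (ltW (N0 i)) lpnormR_le.
have P0 : 0 < \prod_i N i by apply: prodr_gt0.
apply: le_trans (scale_bound V0 (ltW B0) P0 hN) _.
apply: le_trans (_ : `|sigmaH E (fun i v => (N i)^-1 * x i v)| <= _).
  rewrite sigmaHZ prodfV normrM normfV (ger0_norm (ltW P0)) [leRHS]mulrC.
  by rewrite ler_wpM2r // invr_ge0 ltW.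
rewrite -normc_real -sigmaH_real; apply: (ub_le_sup ubound_mu).
exists (fun i v => ((N i)^-1 * x i v)%:C%C) => //= i.
by rewrite lpnormC_real lpnormRZ ?invr_ge0 ?(ltW (N0 i)) // mulVf ?gt_eqF.
Qed.

End Norms.

(** * Nonnegativity in degenerate cases *)

Lemma sup_nneg (R : realType) (A : set R) : (forall x, A x -> 0 <= x) -> 0 <= sup A.
Proof.
(* Without a supremum, [sup] takes the default value 0. *)
move=> h; have [hs|hs] := pselect (has_sup A); last by rewrite sup_out.
have [[x Ax] _] := hs; exact: le_trans (h _ Ax) (sup_upper_bound hs Ax).
Qed.

Lemma mu_nneg (R : realType) (V : finType) (r : nat) (E : {set {set V}}) (p : R) : 0 <= mu r E p.
Proof. by apply: sup_nneg => _ [x _ <-]; exact: normc_ge0. Qed.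

Lemma regular0 (V : finType) (r : nat) (E : {set {set V}}) :
  (0 < r)%N -> uniform r E -> regular 0 E -> E = finset.set0.
Proof.
move=> r0 uE rE; apply/eqP/finset.set0Pn => -[e eE].
have /card_gt0P[v ve] : (0 < #|e|)%N by rewrite uE.
by have /eqP := rE v; rewrite cards_eq0 => /eqP/setP/(_ e); rewrite !inE eE ve.
Qed.

Lemma lambda2_regular0 (R : realType) (V : finType) (m : nat) (E : {set {set V}}) (p : R) :
  uniform m.+1 E -> regular 0 E -> 0 <= lambda2 m.+1 E p.
Proof.
move=> uE rE; apply: sup_nneg => _ [x _ <-].
rewrite sigmaHE big1 // => f _; rewrite /sigma_coef /qE (regular0 _ uE rE) // cards0.
by rewrite inE muln0 !mul0r subrr mul0r.
Qed.

(** * Choice of constants and assembly of the three bounds *)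

Lemma exists_lambda2_vector (R : realType) (m : nat) :
  exists2 c : R, 0 < c & forall (V : finType) (E : {set {set V}}) (d : nat),
    uniform m.+3 E -> regular d E -> (0 < #|V|)%N -> (0 < d)%N ->
    d%:R <= #|V|%:R `^ (2 / 3) :> R ->
    exists2 x : V -> R, (forall v, `|x v| <= 2) &
      c * (#|V|%:R * Num.sqrt d%:R) <= sigmaH E (fun _ : 'I_m.+3 => x).
Proof.
pose P : R := 4 ^+ m.+3.
have P0 : 1 <= P by apply: exprn_ege1; lra.
pose k : R := m.+2%:R.
have k0 : 1 <= k by rewrite ler1n.
(* This makes the cubic condition of [exists_positive_value] read exactly [s ^+ 3 <= n], which is
   what [d <= n^(2/3)] gives. *)
pose eta : R := (512 * P * k ^+ 2)^-1.
have D0 : 0 < 512 * P * k ^+ 2.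
  by apply: mulr_gt0; [lra | apply: exprn_gt0; lra].
have eta0 : 0 < eta by rewrite invr_gt0.
have etaE : 512 * P * k ^+ 2 * eta = 1 by rewrite mulfV ?gt_eqF.
have k2 : 1 <= k ^+ 2 by exact: exprn_ege1.
have Pk : 1 <= P * k ^+ 2 by rewrite -[leLHS]mulr1; apply: ler_pM.
have eta2 : eta <= 2^-1 by rewrite lef_pV2 ?posrE //; lra.
have eta1 : k * eta ^+ 2 <= 4^-1.
  have h1 : k * eta <= 2^-1.
    by rewrite ler_pdivrMr // mulrC ler_pdivlMr //; nra.
  by rewrite expr2 mulrA; nra.
pose dl : R := 32^-1 * 4 ^- m.+3.
have dl0 : 0 < dl by rewrite mulr_gt0 // invr_gt0 exprn_gt0.
pose K : R := 128 * P / eta.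
have K0 : 0 < K by rewrite divr_gt0 //; lra.
pose c0 : R := 4^-1 * (m.+1)%:R ^- m.+1.
have c00 : 0 < c0 by rewrite mulr_gt0 // invr_gt0 exprn_gt0.
pose c1 : R := dl ^+ 2 * eta / 128.
have c10 : 0 < c1 by rewrite !mulr_gt0 // exprn_gt0.
(* [c1] serves the random construction; [c0], from a single edge, serves the case [n < K * s], where
   [s ^+ 3 <= n] yields [s ^+ 2 < K] and [n * s < K ^+ 2]. *)
exists (Num.min c1 (c0 / K ^+ 2)).
  by rewrite lt_min c10 divr_gt0 // exprn_gt0.
move=> V E d uE rE V0 d0 hd.
set n : R := #|V|%:R in hd *; set s := Num.sqrt d%:R.
have n0 : 0 < n by rewrite ltr0n.
have s0 : 0 < s by rewrite sqrtr_gt0 ltr0n.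
have ns0 : 0 <= n * s by rewrite mulr_ge0 // ltW.
have s3 : s ^+ 3 <= n.
  have hs : s <= n `^ 3^-1.
    rewrite -[leRHS]ger0_norm ?powR_ge0 // -sqrtr_sqr ler_wsqrtr //.
    by rewrite -powR_mulrn ?powR_ge0 // -powRrM (mulrC 3^-1).
  apply: le_trans (_ : (n `^ 3^-1) ^+ 3 <= _).
    by rewrite lerXn2r ?nnegrE ?powR_ge0 // ltW.
  by rewrite -powR_mulrn ?powR_ge0 // -powRrM mulVf // powRr1 // ltW.
have [hA|hA] := lerP (128 * P * s) (n * eta).
  have hB : 512 * P * k ^+ 2 * eta * s ^+ 3 <= n by rewrite etaE mul1r.
  have [x hx h] := exists_positive_value uE rE V0 d0 eta0 eta1 eta2 isT erefl hA hB.
  exists x => //; apply: le_trans h.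
  by rewrite ler_wpM2r // ge_min lexx.
have [e eE] : exists e, e \in E.
  have /card_gt0P[v _] := V0.
  have /card_gt0P[e] : (0 < #|[set e in E | v \in e]%SET|)%N by rewrite rE.
  by rewrite inE => /andP[eE _]; exists e.
have [x hx h] := exists_positive_small R uE eE.
exists x => //; apply: le_trans h; rewrite -/c0.
apply: le_trans (_ : c0 / K ^+ 2 * (n * s) <= _).
  by rewrite ler_wpM2r // ge_min lexx orbT.
rewrite mulrAC ler_pdivrMr ?exprn_gt0 // ler_wpM2l ?ltW //.
have nK : n < K * s by rewrite /K mulrAC ltr_pdivlMr.
have sK : s ^+ 2 < K.
  have : s ^+ 2 * s < K * s by apply: le_lt_trans nK; rewrite -exprSr.
  by rewrite ltr_pM2r.
apply: lt_trans (_ : K * s * s < _); first by rewrite ltr_pM2r.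
by rewrite -mulrA -expr2 expr2 ltr_pM2l // -expr2.
Qed.

Theorem theorem1p8 (R : realType) (r : nat) :
  (3 <= r)%N ->
  exists c : R, 0 < c /\
  forall (V : finType) (E : {set {set V}}) (d : nat),
    uniform r E -> regular d E ->
    [/\ ((d%:R : R) <= (#|V|%:R : R) `^ (2 / 3 : R) ->
           forall p : R, 1 <= p ->
             c * (#|V|%:R : R) `^ (1 - r%:R / p) * Num.sqrt (d%:R : R) <= lambda2 r E p),
        ((d%:R : R) < (#|V|%:R : R) ^+ 2 / 4 ->
           forall p : R, 1 <= p ->
             c * (#|V|%:R : R) `^ (1 - r%:R / p) * Num.sqrt (d%:R : R) <= mu r E p) &
        ((4 <= r)%N ->
         (#|V|%:R : R) ^+ 2 / 4 <= (d%:R : R) ->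
         (d%:R : R) <= 2^-1 * ('C(#|V|.-1, r.-1))%:R ->
           forall p : R, 1 <= p ->
             c * (d%:R : R) * (#|V|%:R : R) `^ (- (r%:R / p)) <= mu r E p)].
Proof.
case: r => [|[|[|m]]] // _.
have [c1 c10 H1] := exists_lambda2_vector R m.
pose c2 : R := ((m.+2`!)%:R * 2 ^+ m.+4)^-1.
have c20 : 0 < c2 by rewrite invr_gt0 mulr_gt0 ?exprn_gt0 // ltr0n fact_gt0.
(* One constant for the three parts, the last of which holds with 1 before normalization; [t] below
   is the loss from the norms. *)
pose cm := Num.min c1 (Num.min c2 1).
have cm0 : 0 < cm by rewrite !lt_min c10 c20 ltr01.
pose t : R := 2 ^+ m.+3.
have t0 : 0 < t by rewrite exprn_gt0.
have reduce (a b X c : R) : 0 < X -> a = cm / t * b -> b = X * c -> 0 <= c -> forall c' L,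
    cm <= c' -> (c' * X) / t * c <= L -> a <= L.
  move=> X0 -> -> c0 c' L hc; apply: le_trans.
  have -> : cm / t * (X * c) = cm * (X / t * c) by ring.
  have -> : c' * X / t * c = c' * (X / t * c) by ring.
  by rewrite ler_wpM2r // mulr_ge0 // divr_ge0 // ltW.
exists (cm / t); split; first exact: divr_gt0.
move=> V E d uE rE; set n : R := #|V|%:R.
(* For [d = 0] the left sides vanish; normalization needs a strictly positive value, so this case is
   separate. *)
have [d0|d0] := posnP d.
  rewrite {}d0 in rE *; split=> *; rewrite ?sqrtr0 ?mulr0 ?mul0r ?mu_nneg //.
  exact: lambda2_regular0.
have dR : 0 < d%:R :> R by rewrite ltr0n.
have s0 : 0 < Num.sqrt d%:R :> R by rewrite sqrtr_gt0.
(* On the empty vertex set every [d] is allowed by [regular], but each part then bounds the positive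
   [d] above by 0. *)
have [V0|V0] := posnP #|V|.
  split; rewrite /n ?V0.
  - by rewrite powR0 ?mulf_neq0 ?invr_eq0 //; lra.
  - by rewrite expr0n mul0r; lra.
  - by move=> _ _; rewrite bin0n mulr0; lra.
have n0 : 0 < n by rewrite ltr0n.
have powE (p : R) : n `^ (1 - m.+3%:R / p) = n * n `^ (- (m.+3%:R / p)).
  rewrite powRD; last by apply/implyP => _; rewrite gt_eqF.
  by rewrite powRr1 // ltW.
have ns0 : 0 < n * Num.sqrt d%:R by exact: mulr_gt0.
split.
- move=> hd p p1; have [x hx h] := H1 V E d uE rE V0 d0 hd.
  apply: (reduce _ (n * Num.sqrt d%:R * n `^ (- (m.+3%:R / p))) _ _ ns0 _ erefl (powR_ge0 _ _) c1).
  + by rewrite powE; ring.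
  + by rewrite ge_min lexx.
  + by apply: (lambda2_ge p1 V0 hx _ h); exact: mulr_gt0.
- move=> hd p p1; have [x hx h] := exists_multilinear_sqrt uE rE V0 isT d0 hd.
  apply: (reduce _ (n * Num.sqrt d%:R * n `^ (- (m.+3%:R / p))) _ _ ns0 _ erefl (powR_ge0 _ _) c2).
  + by rewrite powE; ring.
  + by rewrite !ge_min lexx orbT.
  + apply: (mu_ge p1 V0 _ _ h); last exact: mulr_gt0.
    by move=> i v; apply: le_trans (hx i v) _; lra.
- move=> _ _ _ p p1; have [x hx h] := exists_multilinear_degree R uE rE V0.
  apply: (reduce _ (d%:R * n `^ (- (m.+3%:R / p))) _ _ dR _ erefl (powR_ge0 _ _) 1).
  + by rewrite mulrA.
  + by rewrite !ge_min lexx !orbT.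
  + rewrite mul1r; apply: (mu_ge p1 V0 _ dR h).
    by move=> i v; apply: le_trans (hx i v) _; lra.
Qed.
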